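(* For any infinite constellation $S$ of complex dimension $nt$ with NLD $\delta$, transmitted over $n$ uses of the $t\times r$ MIMO fast fading channel ($t\le r$) described in the context, the average error probability satisfies $$P_e(S)\ge\Pr\left\{\|\mathbf z'^n\|^2\ge e^{-\delta/t}\left(\frac{\det(\mathbf H^{n\dagger}\mathbf H^n)}{V_{2nt}}\right)^{\frac1{nt}}\right\},$$ where $\mathbf z'^n\sim CN(0,\sigma^2I_{nt})$ is independent of $\mathbf H^n$ and $V_{2nt}=\frac{\pi^{nt}}{nt\,\Gamma(nt)}$ is the volume of the unit ball in $\mathbb R^{2nt}$.
   Context: Channel: $\mathbf y_i=\mathbf H_i\mathbf x_i+\mathbf z_i$, $\mathbf x_i\in\mathbb C^t$, $\mathbf H_i\in\mathbb C^{r\times t}$ i.i.d. over $i$ with i.i.d. circularly symmetric $CN(0,1)$ entries, $\mathbf z_i\sim CN(0,\sigma^2I_r)$ i.i.d., all independent, receiver knows $\mathbf H_i$, $t\le r$. $\mathbf H^n=\mathrm{diag}(\mathbf H_1,\dots,\mathbf H_n)$ (block diagonal). An IC of complex dimension $l=nt$ is a countable $S\subset\mathbb C^l$; $\mathrm{Cb}(a,l)=\{\mathbf x\in\mathbb C^l:|\mathrm{Re}x_i|,|\mathrm{Im}x_i|<a/2\}$; density $\gamma=\limsup_a|S\cap\mathrm{Cb}(a,l)|/a^{2l}$; NLD $\delta=\frac1n\ln\gamma$. $P_e(S)=E\{\limsup_a\frac{1}{M(S_{\mathbf H^n},a)}\sum_{s_{rc}\in S_{\mathbf H^n}\cap\mathbf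 H^n\mathrm{Cb}(a,l)}\Pr\{s_{rc}+\mathbf z^n\notin W(s_{rc})\mid\mathbf H^n\}\}$ with $S_{\mathbf H^n}=\{\mathbf H^ns:s\in S\}$, $M(S_{\mathbf H^n},a)=|S_{\mathbf H^n}\cap\mathbf H^n\mathrm{Cb}(a,l)|$, $W$ the Voronoi cell in $S_{\mathbf H^n}$. *)

(* Defs.v *)
From HB Require Import structures.
From mathcomp Require Import all_boot all_order all_algebra.
From mathcomp Require Import all_classical all_reals all_analysis.
From mathcomp Require Import complex.
Set Implicit Arguments. Unset Strict Implicit. Unset Printing Implicit Defensive.
Import Order.TTheory GRing.Theory Num.Theory.
Import numFieldTopology.Exports.
Local Open Scope classical_set_scope.
Local Open Scope ring_scope.

Lemma blk_lt (n r : nat) (I : 'I_(n * r)) : (I %/ r < n)%N.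
Proof.
case: I => i /= Hi; case: r Hi => [|r] Hi; first by rewrite muln0 in Hi.
by rewrite ltn_divLR.
Qed.

Lemma off_lt (n r : nat) (I : 'I_(n * r)) : (I %% r < r)%N.
Proof.
case: I => i /= Hi; case: r Hi => [|r] Hi; first by rewrite muln0 in Hi.
by rewrite ltn_mod.
Qed.

Definition blk (n r : nat) (I : 'I_(n * r)) : 'I_n := Ordinal (blk_lt I).
Definition off (n r : nat) (I : 'I_(n * r)) : 'I_r := Ordinal (off_lt I).

Section Defs.
Variable R : realType.
Local Notation C := (R[i]).

Definition blockdiag (n r t : nat) (H : 'I_n -> 'M[C]_(r, t)) : 'M[C]_(n * r, n * t) :=
  \matrix_(I < n * r, J < n * t)
     if blk I == blk J then H (blk I) (off I) (off J) else 0.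

Definition adjoint (m l : nat) (A : 'M[C]_(m, l)) : 'M[C]_(l, m) :=
  (map_mx (@conjc R) A)^T.

Definition normsq (m : nat) (x : 'cV[C]_m) : R :=
  \sum_(k < m) ((complex.Re (x k 0)) ^+ 2 + (complex.Im (x k 0)) ^+ 2).

Definition cube (a : R) (l : nat) : set 'cV[C]_l :=
  [set x | forall k : 'I_l, `|complex.Re (x k 0)| < a / 2 /\ `|complex.Im (x k 0)| < a / 2].

Definition ecard (U : choiceType) (A : set U) : \bar R := (\esum_(x in A) 1)%E.

Definition limsup_pinfty (f : R -> \bar R) : \bar R := limf_esup f (pinfty_nbhs R).

Definition density (l : nat) (S : set 'cV[C]_l) : \bar R :=
  limsup_pinfty (fun a => (ecard (S `&` @cube a l)%classic * ((a ^+ (2 * l)%N)^-1)%:E)%E).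

Definition voronoi (m : nat) (S' : set 'cV[C]_m) (s : 'cV[C]_m) : set 'cV[C]_m :=
  [set y | forall s', S' s' -> normsq (y - s) <= normsq (y - s')].

(* volume of the unit ball of R^(2k): pi^k / (k Gamma(k)) = pi^k / k! *)
Definition Vball (k : nat) : R := pi ^+ k / (k`!)%:R.

Section Prob.
Context (d : measure_display) (T : measurableType d) (P : probability T R).

Definition mutually_independent (I : finType) (X : I -> T -> R) : Prop :=
  forall (J : {set I}) (A : I -> set R), (forall i, measurable (A i)) ->
    P (\bigcap_(i in [set i | i \in J]) (X i @^-1` A i)) =
    (\prod_(i in J) P (X i @^-1` A i))%E.

Definition is_gaussian0 (s : R) (X : T -> R) : Prop :=
  forall A : set R, measurable A -> P (X @^-1` A) = normal_prob 0 s A.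

(* average error probability P_e(S): for w fixed, the channel realisation is
   Hn w; the inner (conditional, given H^n) probability is taken over the
   noise z, which is independent of H^n. *)
Definition err_prob (m l : nat) (S : set 'cV[C]_l)
    (Hn : T -> 'M[C]_(m, l)) (z : T -> 'cV[C]_m) : \bar R :=
  (\int[P]_w
     limsup_pinfty (fun a =>
       let SH := (fun s => Hn w *m s) @` S in
       let box := SH `&` ((fun s => Hn w *m s) @` @cube a l) in
       (\esum_(y in box) P [set w' | ~ voronoi SH y ((y + z w')%R)]) *
       ((fine (ecard box))^-1)%:E))%E.

Definition chan_mat (n r t : nat) (Hre Him : 'I_n -> 'I_r -> 'I_t -> T -> R)
    (w : T) : 'M[C]_(n * r, n * t) :=
  blockdiag (fun i => \matrix_(a < r, b < t) (Hre i a b w +i* Him i a b w)%C).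

Definition cvec (k : nat) (Wre Wim : 'I_k -> T -> R) (w : T) : 'cV[C]_k :=
  \col_(j < k) (Wre j w +i* Wim j w)%C.

Definition HW_family (n r t k : nat) (Hre Him : 'I_n -> 'I_r -> 'I_t -> T -> R)
    (Wre Wim : 'I_k -> T -> R) :
    ('I_n * 'I_r * 'I_t * bool + 'I_k * bool)%type -> T -> R :=
  fun x => match x with
           | inl (i, a, b, c) => if c then Hre i a b else Him i a b
           | inr (j, c) => if c then Wre j else Wim j
           end.

End Prob.
End Defs.

(* Main.v *)
(** Fix a realisation H of the channel of full column rank, with D = det(H^*H).
    In the coordinates u of the constellation the noise has density
    phi(u) = h(|Hu|^2) with h decreasing, and a codeword s is decoded correctly
    iff the noise lies in its cell, a region of the constellation space.  Since
    {u : |Hu|^2 < r^2} is a superlevel set of phi, every region W satisfies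
      phi(W) <= phi(|Hu|^2 < r^2) + h(r^2) (vol W - vol(|Hu|^2 < r^2)),
    an inequality affine in vol W, so it can be averaged over the codewords of a
    large cube without any convexity argument.  Cells truncated to a cube of
    side 2 rho are essentially disjoint and fit in the cube of side a + 2 rho,
    hence their average volume is at most about 1/gamma, which is exactly
    vol(|Hu|^2 < r^2) for the radius of the theorem.  Letting a, then rho, tend
    to infinity bounds the conditional error probability below by
    P(|z'|^2 >= r^2 | H); integrating over H, which is almost surely of full
    rank, gives the claim. *)
Require Import Defs.
From HB Require Import structures.
From mathcomp Require Import all_boot all_order all_algebra.
From mathcomp Require Import all_classical all_reals all_analysis.
From mathcomp Require Import complex measurable_realfun ring lra.
Import Order.TTheory GRing.Theory Num.Theory.
Import numFieldTopology.Exports.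
Local Open Scope classical_set_scope.
Local Open Scope ring_scope.

Set Implicit Arguments.
Unset Strict Implicit.
Unset Printing Implicit Defensive.

(** * Lebesgue measure on column vectors *)

(** The noise has at least as many coordinates as the constellation, but its component orthogonal to
    the image of H adds the same amount to both sides of every distance comparison, so only the
    projection matters. The density of that projection comes out up to a constant, fixed by equating
    total masses. A square T with T^*T = H^*H gives |Hu| = |Tu|, and the realification of T has
    determinant |det T|^2 = D. Hence D itself, not its square root, is the Jacobian, and |Tu| is
    distributed as |z'| with z' of dimension nt. Cells are truncated because those of codewords near
    the boundary of the large cube may be huge or unbounded; the price is the noise mass outside the
    small cube, the same for every codeword. As gamma is only an upper limit, the volume comparison
    is sharp only for some arbitrarily large a. This suffices, because the error probability is an
    upper limit as well. *)

Section cv_measurable.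
Context (R : realType) (N : nat).

(** The product sigma-algebra: measurability of a vector-valued map is then checked coordinate by
    coordinate. *)
Definition cv_gen : set (set 'cV[R]_N) :=
  [set (fun x : 'cV[R]_N => x k 0) @^-1` A | k in [set: 'I_N] & A in measurable].

Let cv0 : <<s cv_gen >> set0. Proof. exact: sigma_algebra0. Qed.
Let cvC A : <<s cv_gen >> A -> <<s cv_gen >> (~` A).
Proof. exact: sigma_algebraC. Qed.
Let cvU (F : (set 'cV[R]_N)^nat) :
  (forall i, <<s cv_gen >> (F i)) -> <<s cv_gen >> (\bigcup_i (F i)).
Proof. exact: sigma_algebra_bigcup. Qed.

Definition cv_display : measure_display. Proof. exact: default_measure_display. Qed.

HB.instance Definition _ :=
  @isMeasurable.Build cv_display 'cV[R]_N (<<s cv_gen >>) cv0 cvC cvU.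

End cv_measurable.

Section cv_measurable_theory.
Context (R : realType).

Lemma measurable_coord N (k : 'I_N) :
  measurable_fun [set: 'cV[R]_N] (fun x : 'cV[R]_N => x k 0).
Proof.
move=> _ Y mY; rewrite setTI; apply: sub_sigma_algebra => /=.
by exists k => //; exists Y.
Qed.

Lemma measurable_fun_cvP d (T : measurableType d) N (f : T -> 'cV[R]_N) :
  (forall k, measurable_fun setT (fun x => f x k 0)) -> measurable_fun setT f.
Proof.
move=> mf; apply: (@measurability _ _ _ _ _ _ (@cv_gen R N)) => //.
move=> _ [_ [k _ [A mA <-]] <-]; rewrite setTI -comp_preimage.
by rewrite -[X in measurable X]setTI; exact: mf.
Qed.

End cv_measurable_theory.

Section image_measure.
Context d1 d2 (T1 : measurableType d1) (T2 : measurableType d2) (R : realType).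
Variables (m : {measure set T1 -> \bar R}) (f : T1 -> T2).

Definition image_measure (mf : measurable_fun [set: T1] f) :
  {measure set T2 -> \bar R}.
Proof. refine (pushforward m f : {measure set T2 -> \bar R}). exact: mf. Defined.

Lemma image_measureE (mf : measurable_fun [set: T1] f) A :
  image_measure mf A = m (f @^-1` A).
Proof. by []. Qed.

Lemma ge0_integral_image_measure (mf : measurable_fun [set: T1] f)
    (g : T2 -> \bar R) : measurable_fun [set: T2] g -> (forall x, 0 <= g x)%E ->
  (\int[image_measure mf]_y g y = \int[m]_x g (f x))%E.
Proof.
by move=> mg g0; rewrite (ge0_integral_pushforward mf) ?preimage_setT.
Qed.

End image_measure.

Section lebesgue_cv.
Context (R : realType).
Local Notation leb := (@lebesgue_measure R).

Definition box N (A : 'I_N -> set R) : set 'cV[R]_N :=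
  [set x | forall k, A k (x k 0)].

Lemma measurable_box N (A : 'I_N -> set R) :
  (forall k, measurable (A k)) -> measurable (box A).
Proof.
move=> mA; rewrite (_ : box A =
    \bigcap_(k in [set: 'I_N]) ((fun x : 'cV[R]_N => x k 0) @^-1` A k)); last first.
  by apply/seteqP; split => x /= h k; [move=> _; exact: h|exact: h].
apply: fin_bigcap_measurable => // k _.
by rewrite -[X in measurable X]setTI; exact: measurable_coord.
Qed.

Lemma boxI N (A B : 'I_N -> set R) :
  box A `&` box B = box (fun k => A k `&` B k).
Proof. by apply/seteqP; split=> x /=; [case=> h1 h2 k|move=> h; split=> k; case: (h k)]. Qed.

Definition mboxes N : set (set 'cV[R]_N) :=
  [set B | exists2 A, (forall k, measurable (A k)) & B = box A].

Lemma cv_measurable_boxes N : @measurable _ 'cV[R]_N = <<s @mboxes N >>.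
Proof.
apply/seteqP; split.
  apply: smallest_sub; first exact: smallest_sigma_algebra.
  move=> _ [k _ [A mA <-]]; apply: sub_sigma_algebra.
  exists (fun j => if j == k then A else setT).
    by move=> j; case: ifP.
  apply/seteqP; split => x /=; first by move=> Ax j; case: ifP => // /eqP ->.
  by move=> /(_ k); rewrite eqxx.
apply: smallest_sub; first exact: sigma_algebra_measurable.
by move=> _ [A mA ->]; exact: measurable_box.
Qed.

Definition symitv (n : nat) : set R := `]- n%:R, n%:R[%classic.

Definition cube_box N (n : nat) : set 'cV[R]_N := box (fun _ => symitv n).

Lemma cube_box_cover N : \bigcup_n (@cube_box N n) = setT.
Proof.
apply/seteqP; split => // x _.
exists (Num.truncn (\sum_k `|x k 0|)).+1 => // k /=.
rewrite /symitv /= in_itv /= -ltr_norml.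
apply: le_lt_trans (truncnS_gt _).
by rewrite (bigD1 k) //= lerDl sumr_ge0.
Qed.

(** Boxes are closed under intersection and generate the sigma-algebra, and the cubes exhaust the
    space. Every identification of measures on column vectors below goes through this criterion. *)
Lemma cv_measure_unique N (m1 m2 : {measure set 'cV[R]_N -> \bar R}) :
  (forall A, (forall k, measurable (A k)) -> m1 (box A) = m2 (box A)) ->
  (forall n, (m1 (@cube_box N n) < +oo)%E) ->
  forall B, measurable B -> m1 B = m2 B.
Proof.
move=> m12 moo B mB.
apply: (measure_unique (@mboxes N) (@cube_box N)) => //.
- exact: cv_measurable_boxes.
- move=> _ _ [A mA ->] [A' mA' ->]; rewrite boxI; eexists; last reflexivity.
  by move=> k; exact: measurableI.
- by move=> n; exists (fun _ => symitv n) => // k; exact: measurable_itv.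
- exact: cube_box_cover.
- by move=> _ [A mA ->]; exact: m12.
Qed.

Lemma leb_symitv_lty (n : nat) : (leb (symitv n) < +oo)%E.
Proof. by rewrite /symitv lebesgue_measure_itv /=; case: ifP => // _; rewrite -EFinB ltry. Qed.

Lemma prod_lty (I : finType) (f : I -> \bar R) :
  (forall i, (0 <= f i)%E) -> (forall i, (f i < +oo)%E) -> (\prod_i f i < +oo)%E.
Proof.
move=> f0 foo; suff : (0 <= \prod_i f i < +oo)%E by case/andP.
elim/big_ind: _ => [|x y /andP[x0 xoo] /andP[y0 yoo]|i _]; last by rewrite f0 foo.
  by rewrite ltry lee01.
by rewrite mule_ge0//= lte_mul_pinfty// ge0_fin_numE.
Qed.

Definition vcons N (p : R * 'cV[R]_N) : 'cV[R]_(1 + N) :=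
  col_mx (p.1)%:M p.2.

Lemma vcons0 N p (i : 'I_1) : @vcons N p (lshift N i) 0 = p.1.
Proof. by rewrite /vcons col_mxEu mxE ord1 eqxx. Qed.

Lemma vconsS N p (i : 'I_N) : @vcons N p (rshift 1 i) 0 = p.2 i 0.
Proof. by rewrite /vcons col_mxEd. Qed.

Lemma measurable_vcons N : measurable_fun setT (@vcons N).
Proof.
apply: measurable_fun_cvP => k; case: (split_ordP k) => j ->.
  under eq_fun do rewrite vcons0.
  exact: measurable_fst.
under eq_fun do rewrite vconsS.
apply: (measurableT_comp (measurable_coord j)); exact: measurable_snd.
Qed.

Lemma box_sigma_finite N (m : {measure set 'cV[R]_N -> \bar R}) :
  (forall n, (m (@cube_box N n) < +oo)%E) -> sigma_finite setT m.
Proof.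
move=> moo; exists (@cube_box N); first by rewrite cube_box_cover.
by move=> n; split => //; apply: measurable_box => k; exact: measurable_itv.
Qed.

Section box_sfinite.
Context N (m : {measure set 'cV[R]_N -> \bar R}).
Hypothesis moo : forall n, (m (@cube_box N n) < +oo)%E.

(** An alias that carries the finiteness proof as an argument, so that a sigma-finite structure,
    required by product measures and Tonelli, can be attached to it. *)
Definition box_sigma_finite_measure of (forall n, (m (@cube_box N n) < +oo)%E) :
  set 'cV[R]_N -> \bar R := m.

HB.instance Definition _ := Measure.on (box_sigma_finite_measure moo).

HB.instance Definition _ := Measure_isSigmaFinite.Build _ _ _
  (box_sigma_finite_measure moo) (box_sigma_finite moo).

End box_sfinite.

(** Induction on the dimension: the product of the line with the previous measure is pushed forward
    along [vcons]. *)
Lemma lebN_exists N : exists m : {measure set 'cV[R]_N -> \bar R},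
  forall A, (forall k, measurable (A k)) -> m (box A) = (\prod_(k < N) leb (A k))%E.
Proof.
elim: N => [|N [m mE]].
  (* In dimension 0 the space is one point, whose mass is the empty product 1. *)
  exists (@dirac _ 'cV[R]_0 0 R) => A mA.
  rewrite big_ord0 /= /dirac indicE mem_set //; by case.
have mfin n : (m (@cube_box N n) < +oo)%E.
  rewrite mE; last by move=> k; exact: measurable_itv.
  apply: prod_lty => k; [exact: measure_ge0|exact: leb_symitv_lty].
pose m' : {sigma_finite_measure set 'cV[R]_N -> \bar R} :=
  box_sigma_finite_measure mfin.
exists (image_measure (leb \x m')%E (@measurable_vcons N)) => A mA.
rewrite big_ord_recl image_measureE.
have -> : @vcons N @^-1` box A = A ord0 `*` box (fun k => A (lift ord0 k)).
  have e0 : lshift N (ord0 : 'I_1) = ord0 by exact: val_inj.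
  apply/seteqP; split => [[a v] /= h|[a v] /= [h1 h2] k].
    split=> [|k]; first by have := h (lshift N (ord0 : 'I_1)); rewrite vcons0 e0.
    by have := h (rshift 1 k); rewrite vconsS rshift1.
  case: (split_ordP (k : 'I_(1 + N))) => j ->.
    by rewrite vcons0 ord1 e0.
  by rewrite vconsS rshift1; exact: h2.
rewrite [LHS](product_measure1E (leb : {sigma_finite_measure set _ -> \bar R}) m'
  (mA ord0)); first by congr (_ * _)%E; exact: mE.
by apply: measurable_box => k; exact: mA.
Qed.

Definition lebN N : set 'cV[R]_N -> \bar R := sval (cid (lebN_exists N)).

HB.instance Definition _ N := Measure.on (@lebN N).

Lemma lebN_box N (A : 'I_N -> set R) : (forall k, measurable (A k)) ->
  lebN (box A) = (\prod_(k < N) leb (A k))%E.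
Proof. by move=> mA; rewrite /lebN; case: cid => m /= mE; exact: mE. Qed.

Lemma lebN_cube_box_lty N n : (lebN (@cube_box N n) < +oo)%E.
Proof.
rewrite lebN_box; last by move=> k; exact: measurable_itv.
by apply: prod_lty => k; [exact: measure_ge0|exact: leb_symitv_lty].
Qed.

HB.instance Definition _ N := Measure_isSigmaFinite.Build _ _ _
  (@lebN N) (box_sigma_finite (@lebN_cube_box_lty N)).

Lemma lebN_unique N (m : {measure set 'cV[R]_N -> \bar R}) :
  (forall A, (forall k, measurable (A k)) ->
    m (box A) = (\prod_(k < N) leb (A k))%E) ->
  forall B, measurable B -> lebN B = m B.
Proof.
move=> mE; apply: cv_measure_unique => [A mA|n]; last exact: lebN_cube_box_lty.
by rewrite [LHS](lebN_box mA) mE.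
Qed.

End lebesgue_cv.
Arguments lebN {R N}.

(** * Iterated integrals, translations and affine substitutions *)

Section tonelli.
Context (R : realType).
Local Notation leb := (@lebesgue_measure R).

Lemma measurable_fun_col_mx d (T : measurableType d) N1 N2
    (g : T -> 'cV[R]_N1) (h : T -> 'cV[R]_N2) :
  measurable_fun setT g -> measurable_fun setT h ->
  measurable_fun setT (fun t => col_mx (g t) (h t)).
Proof.
move=> mg mh; apply: measurable_fun_cvP => k; case: (split_ordP k) => j ->.
  under eq_fun do rewrite col_mxEu.
  exact: (measurableT_comp (measurable_coord j)).
under eq_fun do rewrite col_mxEd.
exact: (measurableT_comp (measurable_coord j)).
Qed.

Lemma measurable_col_mx N1 N2 :
  measurable_fun setT (fun p : 'cV[R]_N1 * 'cV[R]_N2 => col_mx p.1 p.2).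
Proof. by apply: measurable_fun_col_mx. Qed.

Lemma lebN_col_mx N1 N2 B : measurable B ->
  lebN B = image_measure (@lebN R N1 \x @lebN R N2)%E (@measurable_col_mx N1 N2) B.
Proof.
move: B; apply: lebN_unique => A mA; rewrite image_measureE.
have -> : (fun p : 'cV[R]_N1 * 'cV[R]_N2 => col_mx p.1 p.2) @^-1` box A =
    box (fun k => A (lshift N2 k)) `*` box (fun k => A (rshift N1 k)).
  apply/seteqP; split => [[x y] /= h|[x y] /= [h1 h2] k].
    by split=> k; [have := h (lshift N2 k); rewrite col_mxEu
                  |have := h (rshift N1 k); rewrite col_mxEd].
  by case: (split_ordP k) => j ->; rewrite ?col_mxEu ?col_mxEd.
rewrite [LHS](product_measure1E (@lebN R N1) (@lebN R N2)); last 2 first.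
- exact: measurable_box.
- exact: measurable_box.
by rewrite [X in (X * _)%E]lebN_box // [X in (_ * X)%E]lebN_box // big_split_ord.
Qed.

Lemma lebN_tonelli N1 N2 (f : 'cV[R]_(N1 + N2) -> \bar R) :
  measurable_fun setT f -> (forall x, 0 <= f x)%E ->
  (\int[lebN]_z f z = \int[lebN]_x \int[lebN]_y f (col_mx x y))%E.
Proof.
move=> mf f0.
rewrite (eq_measure_integral (image_measure (lebN \x lebN)%E
  (@measurable_col_mx N1 N2))); last by move=> B mB _; exact: lebN_col_mx.
rewrite ge0_integral_image_measure // fubini_tonelli1 //.
by apply: measurableT_comp => //; exact: measurable_col_mx.
Qed.

Lemma lebN_tonelliC N1 N2 (f : 'cV[R]_(N1 + N2) -> \bar R) :
  measurable_fun setT f -> (forall x, 0 <= f x)%E ->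
  (\int[lebN]_z f z = \int[lebN]_y \int[lebN]_x f (col_mx x y))%E.
Proof.
move=> mf f0; rewrite lebN_tonelli //.
apply: (@fubini_tonelli _ _ _ _ _ lebN lebN (fun p : 'cV[R]_N1 * 'cV[R]_N2 => f (col_mx p.1 p.2))) => //=.
by apply: measurableT_comp => //; exact: measurable_col_mx.
Qed.

Definition cv1 (a : R) : 'cV[R]_1 := a%:M.

Lemma measurable_cv1 : measurable_fun setT cv1.
Proof.
apply: measurable_fun_cvP => k; rewrite (_ : (fun x => _) = id) //.
by apply/funext => x; rewrite /cv1 mxE ord1 eqxx.
Qed.

Lemma measurable_fun_cv1 d (T : measurableType d) (g : T -> R) :
  measurable_fun setT g -> measurable_fun setT (fun t => cv1 (g t)).
Proof. by move=> mg; exact: (measurableT_comp measurable_cv1 mg). Qed.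

Lemma lebN1_integral (f : 'cV[R]_1 -> \bar R) :
  measurable_fun setT f -> (forall x, 0 <= f x)%E ->
  (\int[lebN]_z f z = \int[leb]_x f (cv1 x))%E.
Proof.
move=> mf f0.
rewrite (eq_measure_integral (image_measure leb measurable_cv1)).
  by rewrite ge0_integral_image_measure.
move=> B mB _; apply: lebN_unique mB => A mA; rewrite image_measureE big_ord1.
congr (leb _); apply/seteqP; split => x /=.
  by move=> /(_ ord0); rewrite mxE eqxx.
by move=> h k; rewrite /cv1 mxE ord1 eqxx.
Qed.

Lemma lebNS_integral N (f : 'cV[R]_(1 + N) -> \bar R) :
  measurable_fun setT f -> (forall x, 0 <= f x)%E ->
  (\int[lebN]_z f z = \int[lebN]_v \int[leb]_x f (col_mx (cv1 x) v))%E.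
Proof.
move=> mf f0; rewrite lebN_tonelliC //; apply: eq_integral => v _.
rewrite lebN1_integral //; apply: (measurableT_comp mf).
exact: measurable_fun_col_mx.
Qed.

Lemma lebNS_integralC N (f : 'cV[R]_(1 + N) -> \bar R) :
  measurable_fun setT f -> (forall x, 0 <= f x)%E ->
  (\int[lebN]_z f z = \int[leb]_x \int[lebN]_v f (col_mx (cv1 x) v))%E.
Proof.
move=> mf f0; rewrite lebN_tonelli // lebN1_integral //.
  apply: (@measurable_fun_fubini_tonelli_F _ _ _ _ _ lebN (fun p => f (col_mx p.1 p.2))) => //.
  by apply: measurableT_comp => //; exact: measurable_col_mx.
by move=> x; apply: integral_ge0.
Qed.

Lemma measurable_affine (a b : R) : measurable_fun [set: R] (fun x => a * x + b).
Proof. by apply: measurable_funD => //; exact: measurable_funM. Qed.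

(** The right-hand side is a measure in B, so it is enough to compare on half-open intervals. A
    negative slope exchanges the open and the closed end, without effect on the length. *)
Lemma leb_affine (a b : R) (B : set R) : a != 0 -> measurable B ->
  leb B = (`|a|%:E * leb ((fun x => a * x + b)%R @^-1` B))%E.
Proof.
move=> a0 mB.
have na0 : 0 <= `|a| by [].
pose mu : {measure set (measurableTypeR R) -> \bar R} :=
  mscale (NngNum na0) (image_measure leb
    (measurable_affine a b : measurable_fun setT
      (fun x : measurableTypeR R => (a * x + b)%R : measurableTypeR R))).
have muE C : mu C = (`|a|%:E * leb ((fun x => a * x + b)%R @^-1` C))%E by [].
apply: (@lebesgue_measure_unique R mu) => // _ [[u v] _ <-] /=.
rewrite muE lebesgue_measure_itv /= lte_fin.
have [ag0|al0|ae0] := ltgtP a 0; last by rewrite ae0 eqxx in a0.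
- rewrite (_ : _ @^-1` _ = `[(v - b) / a, (u - b) / a[%classic); last first.
    apply/seteqP; split => x /=; rewrite !in_itv /= => /andP[h1 h2]; apply/andP; split.
    + by rewrite ler_ndivrMr // lerBrDr mulrC.
    + by rewrite ltr_ndivlMr // ltrBlDr mulrC.
    + by rewrite -ltrBlDr mulrC -ltr_ndivlMr.
    + by rewrite -lerBrDr mulrC -ler_ndivrMr.
  rewrite lebesgue_measure_itv /= lte_fin ltr_ndivrMr // divfK //.
  rewrite ltrD2r; case: ifPn => uv; last by rewrite mule0.
  rewrite -!EFinB -EFinM ltr0_norm //; congr EFin; field; exact: a0.
- rewrite (_ : _ @^-1` _ = `](u - b) / a, (v - b) / a]%classic); last first.
    apply/seteqP; split => x /=; rewrite !in_itv /= => /andP[h1 h2]; apply/andP; split.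
    + by rewrite ltr_pdivrMr // ltrBlDr mulrC.
    + by rewrite ler_pdivlMr // lerBrDr mulrC.
    + by rewrite -ltrBlDr mulrC -ltr_pdivrMr.
    + by rewrite -lerBrDr mulrC -ler_pdivlMr.
  rewrite lebesgue_measure_itv /= lte_fin ltr_pdivlMr // divfK //.
  rewrite ltrD2r; case: ifPn => uv; last by rewrite mule0.
  rewrite -!EFinB -EFinM gtr0_norm //; congr EFin; field; exact: a0.
Qed.

Lemma ge0_integral_affine (a b : R) (f : R -> \bar R) : a != 0 ->
  measurable_fun setT f -> (forall x, 0 <= f x)%E ->
  (\int[leb]_x f (a * x + b)%R = (`|a|^-1)%:E * \int[leb]_x f x)%E.
Proof.
move=> a0 mf f0.
have na0 : 0 <= `|a| by [].
pose maff : measurable_fun setT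
  (fun x : measurableTypeR R => (a * x + b)%R : measurableTypeR R) :=
  measurable_affine a b.
rewrite -(ge0_integral_image_measure leb maff) //.
have -> : (\int[leb]_x f x =
    \int[mscale (NngNum na0) (image_measure leb maff)]_x f x)%E.
  by apply: eq_measure_integral => B mB _; exact: leb_affine.
rewrite ge0_integral_mscale //= muleA -EFinM mulVf; last by rewrite normr_eq0.
by rewrite mul1e.
Qed.

Lemma ge0_integral_shift (b : R) (f : R -> \bar R) :
  measurable_fun setT f -> (forall x, 0 <= f x)%E ->
  (\int[leb]_x f (x + b)%R = \int[leb]_x f x)%E.
Proof.
move=> mf f0; have := ge0_integral_affine b (oner_neq0 R) mf f0.
rewrite normr1 invr1 mul1e => <-; apply: eq_integral => x _.
by rewrite mul1r.
Qed.

Lemma measurable_addv N (a : 'cV[R]_N) : measurable_fun setT (fun x : 'cV[R]_N => x + a).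
Proof.
apply: measurable_fun_cvP => k; under eq_fun do rewrite mxE.
by apply: measurable_funD => //; exact: measurable_coord.
Qed.

Lemma lebN_shift N (a : 'cV[R]_N) (f : 'cV[R]_N -> \bar R) :
  measurable_fun setT f -> (forall x, 0 <= f x)%E ->
  (\int[lebN]_x f (x + a)%R = \int[lebN]_x f x)%E.
Proof.
move=> mf f0; rewrite -(ge0_integral_image_measure lebN (measurable_addv a)) //.
apply/esym/eq_measure_integral => B mB _; apply: lebN_unique mB => A mA.
rewrite image_measureE.
rewrite (_ : _ @^-1` _ = box (fun k => (fun x => 1 * x + a k 0) @^-1` A k)); last first.
  by apply/seteqP; split => x h k; have := h k; rewrite /= mul1r mxE.
rewrite [LHS]lebN_box; last first.
  move=> k; rewrite -[X in measurable X]setTI; exact: measurable_affine.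
apply: eq_bigr => k _; rewrite (leb_affine (a k 0) (oner_neq0 R) (mA k)).
by rewrite normr1 mul1e.
Qed.

Lemma measurable_fun_mulmx d (T : measurableType d) M N (A : 'M[R]_(M, N))
    (g : T -> 'cV[R]_N) :
  measurable_fun setT g -> measurable_fun setT (fun t => A *m g t).
Proof.
move=> mg; apply: measurable_fun_cvP => k; under eq_fun do rewrite mxE.
apply: measurable_sum => j; apply: measurable_funM => //.
exact: (measurableT_comp (measurable_coord j) mg).
Qed.

Lemma measurable_fun_addv d (T : measurableType d) N (f g : T -> 'cV[R]_N) :
  measurable_fun setT f -> measurable_fun setT g ->
  measurable_fun setT (fun t => f t + g t).
Proof.
move=> mf mg; apply: measurable_fun_cvP => k; under eq_fun do rewrite mxE.
apply: measurable_funD.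
  exact: (measurableT_comp (measurable_coord k) mf).
exact: (measurableT_comp (measurable_coord k) mg).
Qed.

Lemma measurable_fun_scalev d (T : measurableType d) N (c : R) (g : T -> 'cV[R]_N) :
  measurable_fun setT g -> measurable_fun setT (fun t => c *: g t).
Proof.
move=> mg; apply: measurable_fun_cvP => k; under eq_fun do rewrite mxE.
apply: measurable_funM => //.
exact: (measurableT_comp (measurable_coord k) mg).
Qed.

Lemma measurable_mulmx M N (A : 'M[R]_(M, N)) :
  measurable_fun setT (fun x : 'cV[R]_N => A *m x).
Proof. exact: measurable_fun_mulmx. Qed.

End tonelli.

(** * Linear change of variables *)

Section linear_change.
Context (R : realType).
Local Notation leb := (@lebesgue_measure R).

(* Integrate the indicator of Z at x + c v over (c, x): over x first it gives
   lebN Z for each c, over c first it gives 0. *)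
Lemma lebN_null_lines N (Z : set 'cV[R]_N) (v : 'cV[R]_N) : measurable Z ->
  (forall x, leb [set c | Z (x + c *: v)] = 0%E) -> lebN Z = 0%E.
Proof.
move=> mZ Z0.
pose f (p : R * 'cV[R]_N) : \bar R := (\1_Z (p.2 + p.1 *: v))%:E.
have mline : measurable_fun setT (fun p : R * 'cV[R]_N => p.2 + p.1 *: v).
  apply: measurable_fun_cvP => k; under eq_fun do rewrite !mxE.
  apply: measurable_funD; last by apply: measurable_funM.
  by apply: (measurableT_comp (measurable_coord k)).
have mf : measurable_fun setT f.
  apply/measurable_EFinP; apply: measurableT_comp => //; exact: measurable_indic.
have f0 p : (0 <= f p)%E by rewrite lee_fin.
have := @fubini_tonelli _ _ _ _ _ leb lebN f mf f0.
have -> : (\int[leb]_x \int[lebN]_y f (x, y) = \int[leb]_x (cst (lebN Z) x))%E.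
  apply: eq_integral => c _.
  rewrite (@lebN_shift R N (c *: v) (fun y => (\1_Z y)%:E)) //.
    by rewrite integral_indic // setIT.
  by apply/measurable_EFinP; exact: measurable_indic.
rewrite integral_cst //.
have -> : (\int[lebN]_y \int[leb]_x f (x, y) = 0)%E.
  apply: integral0_eq => y _.
  rewrite -[RHS](Z0 y) -[X in leb X]setIT -integral_indic //.
  have m1 : measurable_fun setT (fun c : R => y + c *: v).
    apply: measurable_fun_cvP => k; under eq_fun do rewrite !mxE.
    by apply: measurable_funD => //; exact: measurable_funM.
  by rewrite -[X in measurable X]setTI; exact: m1.
have lebT : leb [set: R] = +oo%E by rewrite -set_itvNyy lebesgue_measure_itv.
move/eqP; rewrite mule_eq0 => /orP[/eqP//|].
by rewrite [X in X == _]lebT.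
Qed.

Lemma cv1D (a b : R) : cv1 (a + b) = cv1 a + cv1 b.
Proof. by rewrite /cv1 raddfD. Qed.

Lemma cv1K (x : 'cV[R]_1) : cv1 (x 0 0) = x.
Proof. by rewrite /cv1 -mx11_scalar. Qed.

Lemma measurable_shear N (M : 'M[R]_N) (f : 'cV[R]_N -> \bar R) :
  measurable_fun setT f -> measurable_fun setT (fun z => f (M *m z)).
Proof. by move=> mf; apply: (measurableT_comp mf); exact: measurable_mulmx. Qed.

Definition shear_mx N (w : 'M[R]_(1, N)) : 'M[R]_(1 + N) := block_mx 1%:M w 0 1%:M.

Lemma shear_mxK N (w : 'M[R]_(1, N)) : shear_mx (- w) *m shear_mx w = 1%:M.
Proof.
rewrite /shear_mx mulmx_block !mulmx1 !mul1mx !mulmx0 !mul0mx !addr0 !add0r.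
by rewrite subrr -scalar_mx_block.
Qed.

Lemma det_shear_mx N (w : 'M[R]_(1, N)) : \det (shear_mx w) = 1.
Proof. by rewrite det_ublock !det1 mulr1. Qed.

(** For fixed remaining coordinates v, the shear translates the first coordinate by w v, which the
    inner integral does not see. *)
Lemma lebN_shear N (w : 'M[R]_(1, N)) (f : 'cV[R]_(1 + N) -> \bar R) :
  measurable_fun setT f -> (forall x, 0 <= f x)%E ->
  (\int[lebN]_z f (shear_mx w *m z)%R = \int[lebN]_z f z)%E.
Proof.
move=> mf f0; rewrite lebNS_integral //; last exact: measurable_shear.
rewrite [RHS]lebNS_integral //; apply: eq_integral => v _.
rewrite -[RHS](ge0_integral_shift ((w *m v) 0 0)) //.
  apply: eq_integral => x _; rewrite /shear_mx mul_block_col mul0mx !mul1mx add0r.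
  by rewrite cv1D cv1K.
apply: (measurableT_comp mf); apply: measurable_fun_col_mx => //.
exact: measurable_cv1.
Qed.

(** One elimination step with pivot a. The substitution of a x + b v for the first coordinate costs
    |a|; the other coordinates then read S v plus a vector depending on the new first coordinate
    only, with S the Schur complement. After exchanging the integrals, that vector is removed by
    translation and the assumption on S applies. The determinant factors as a times det S. *)
Lemma lebN_block N (a : R) (b : 'M[R]_(1, N)) (c : 'M[R]_(N, 1)) (A : 'M[R]_N)
    (f : 'cV[R]_(1 + N) -> \bar R) :
  let S := A - a^-1 *: (c *m b) in
  (forall g : 'cV[R]_N -> \bar R, measurable_fun setT g -> (forall x, 0 <= g x)%E ->
    (\int[lebN]_x g (S *m x)%R = (`|(\det S)|^-1)%:E * \int[lebN]_x g x)%E) ->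
  a != 0 -> measurable_fun setT f -> (forall x, 0 <= f x)%E ->
  (\int[lebN]_z f (block_mx (a%:M) b c A *m z)%R =
     (`|(\det (block_mx a%:M b c A : 'M[R]_(1 + N)))|^-1)%:E * \int[lebN]_z f z)%E.
Proof.
move=> S IH a0 mf f0.
have -> : \det (block_mx a%:M b c A : 'M[R]_(1 + N)) = a * \det S.
  have -> : block_mx a%:M b c A =
      block_mx 1%:M 0 (a^-1 *: c) 1%:M *m block_mx a%:M b 0 S.
    rewrite mulmx_block !mulmx0 !mul0mx !mul1mx !addr0 mul_mx_scalar scalerA.
    by rewrite mulfV // scale1r /S -scalemxAl addrC subrK.
  by rewrite det_mulmx det_lblock det_ublock !det1 det_scalar1 !mul1r.
rewrite normrM invfM EFinM -muleA.
rewrite lebNS_integral //; last exact: measurable_shear.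
(* Here [p.1] stands for the new first coordinate a x + b v, in terms of which c x + A v equals S v
   + a^-1 c [p.1]. *)
pose F (p : R * 'cV[R]_N) := f (col_mx (cv1 p.1) (S *m p.2 + a^-1 *: (c *m cv1 p.1))).
have mF : measurable_fun setT F.
  apply: (measurableT_comp mf); apply: measurable_fun_col_mx.
    exact: measurable_fun_cv1.
  apply: measurable_fun_addv; first exact: measurable_fun_mulmx.
  by apply/measurable_fun_scalev/measurable_fun_mulmx; exact: measurable_fun_cv1.
transitivity (\int[lebN]_v ((`|a|^-1)%:E * \int[leb]_x F (x, v)))%E.
  apply: eq_integral => v _.
  rewrite -(ge0_integral_affine ((b *m v) 0 0) (f := fun x => F (x, v)) a0); last 2 first.
  - exact: (measurableT_comp mF (pair2_measurable v)).
  - by move=> x; exact: f0.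
  apply: eq_integral => x _; rewrite /F /= mul_block_col; congr (f (col_mx _ _)).
    by rewrite cv1D cv1K /cv1 -scalar_mxM.
  rewrite cv1D cv1K mulmxDr scalerDr /S mulmxBl -scalemxAl -mulmxA.
  rewrite [_ + a^-1 *: (c *m (b *m v))]addrC addrA subrK addrC.
  congr (_ + _).
  by rewrite /cv1 !mul_mx_scalar scalerA mulKf.
rewrite (@ge0_integralZl _ _ _ _ _ _ (fun v => \int[leb]_x F (x, v))%E) //; last 2 first.
- apply: (@measurable_fun_fubini_tonelli_G _ _ _ _ _ leb F mF) => p; exact: f0.
- by move=> v _; apply: integral_ge0 => x _; exact: f0.
congr (_ * _)%E.
rewrite -(@fubini_tonelli _ _ _ _ _ leb lebN F mF (fun p => f0 _)) lebNS_integralC //.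
rewrite -ge0_integralZl //; last 2 first.
- apply: (@measurable_fun_fubini_tonelli_F _ _ _ _ _ lebN (fun p => f (col_mx (cv1 p.1) p.2))) => //.
  apply: (measurableT_comp mf); apply: measurable_fun_col_mx => //.
  exact: measurable_fun_cv1.
- by move=> v _; apply: integral_ge0 => x _; exact: f0.
apply: eq_integral => x _.
have mg : measurable_fun setT (fun y => f (col_mx (cv1 x) y)).
  by apply: (measurableT_comp mf); exact: measurable_fun_col_mx.
rewrite -(lebN_shift (a^-1 *: (c *m cv1 x)) mg) //.
rewrite -(IH (fun y => f (col_mx (cv1 x) (y + a^-1 *: (c *m cv1 x))))) //.
by apply: (measurableT_comp mg); exact: measurable_addv.
Qed.

(* Gaussian elimination; a zero pivot is repaired by adding another row to the
   first one, so permutations of coordinates are never needed. *)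
Lemma lebN_mulmx N (A : 'M[R]_N) (f : 'cV[R]_N -> \bar R) :
  A \in unitmx -> measurable_fun setT f -> (forall x, 0 <= f x)%E ->
  (\int[lebN]_x f (A *m x)%R = (`|(\det A)|^-1)%:E * \int[lebN]_x f x)%E.
Proof.
elim: N A f => [|N IH] A f uA mf f0.
  rewrite det_mx00 normr1 invr1 mul1e; apply: eq_integral => x _.
  by rewrite [_ *m _]flatmx0 [x]flatmx0.
have main (B : 'M[R]_(1 + N)) (g : 'cV[R]_(1 + N) -> \bar R) : B \in unitmx -> B 0 0 != 0 ->
    measurable_fun setT g -> (forall x, 0 <= g x)%E ->
    (\int[lebN]_x g (B *m x)%R = (`|(\det B)|^-1)%:E * \int[lebN]_x g x)%E.
  move=> uB B00 mg g0; move: uB B00; rewrite -[B]submxK.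
  rewrite [ulsubmx B]mx11_scalar; set a := ulsubmx B 0 0 => uB.
  rewrite (_ : 0 = lshift N (0 : 'I_1)); last exact: val_inj.
  rewrite block_mxEul mxE eqxx mulr1n => a0.
  apply: lebN_block => // h mh h0; apply: IH => //.
  move: uB; rewrite !unitmxE !unitfE.
  set b := ursubmx B; set c := dlsubmx B; set A' := drsubmx B.
  have -> : block_mx a%:M b c A' =
      block_mx 1%:M 0 (a^-1 *: c) 1%:M *m block_mx a%:M b 0 (A' - a^-1 *: (c *m b)).
    rewrite mulmx_block !mulmx0 !mul0mx !mul1mx !addr0 mul_mx_scalar scalerA.
    by rewrite mulfV // scale1r -scalemxAl addrC subrK.
  rewrite det_mulmx det_lblock det_ublock !det1 det_scalar1 !mul1r.
  by rewrite mulf_eq0 => /norP[].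
have [A00|A00] := eqVneq ((A : 'M[R]_(1 + N)) 0 0) 0; last exact: main.
have [j Aj] : exists j : 'I_N, (A : 'M[R]_(1 + N)) (rshift 1 j) 0 != 0.
  apply: contrapT => nj; move: uA; rewrite unitmxE unitfE => /negP; apply.
  rewrite (expand_det_col _ 0) big1 // => i _.
  suff -> : A i 0 = 0 by rewrite mul0r.
  case: (split_ordP (i : 'I_(1 + N))) => k ->.
    by rewrite (_ : lshift N k = 0) // ord1; exact: val_inj.
  by apply/eqP/negPn/negP => Ak; apply: nj; exists k.
pose w : 'M[R]_(1, N) := delta_mx 0 j.
pose B : 'M[R]_(1 + N) := shear_mx w *m (A : 'M[R]_(1 + N)).
have AE : A = shear_mx (- w) *m B by rewrite mulmxA shear_mxK mul1mx.
have uB : B \in unitmx.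
  by rewrite unitmx_mul uA andbT unitmxE det_shear_mx unitr1.
have B00 : B 0 0 != 0.
  rewrite /B -[A in shear_mx w *m A](@vsubmxK _ 1 N).
  rewrite /shear_mx mul_block_col (_ : 0 = lshift N (0 : 'I_1)); last exact: val_inj.
  rewrite col_mxEu mul1mx !mxE.
  rewrite (bigD1 j) //= big1 ?addr0 => [|i ij]; last first.
    by rewrite mxE (negbTE ij) andbF mul0r.
  rewrite mxE !eqxx mul1r !mxE.
  rewrite (_ : lshift N 0 = 0); last exact: val_inj.
  by rewrite A00 add0r.
have dAB : \det A = \det B by rewrite /B det_mulmx det_shear_mx mul1r.
rewrite dAB.
rewrite -(lebN_shear (- w) mf f0) -main //; last exact: measurable_shear.
by apply: eq_integral => x _; rewrite [in LHS]AE mulmxA.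
Qed.

End linear_change.

(** * Gaussian vectors *)

Section density_measure.
Context d (T : measurableType d) (R : realType) (m : {measure set T -> \bar R}).
Variable p : T -> \bar R.

Definition density_measure (mp : measurable_fun setT p) (p0 : forall x, (0 <= p x)%E)
  (A : set T) : \bar R := (\int[m]_(x in A) p x)%E.

Hypotheses (mp : measurable_fun setT p) (p0 : forall x, (0 <= p x)%E).
Local Notation dm := (density_measure mp p0).

Let dm0 : dm set0 = 0%E. Proof. exact: integral_set0. Qed.
Let dm_ge0 A : (0 <= dm A)%E. Proof. by apply: integral_ge0. Qed.
Let dm_additive : semi_sigma_additive dm.
Proof.
move=> F mF tF mUF; rewrite /density_measure ge0_integral_bigcup //; last first.
  exact: measurable_funTS.
by apply: is_cvg_ereal_nneg_natsum_cond => n _ _; exact: integral_ge0.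
Qed.

HB.instance Definition _ := isMeasure.Build _ _ _ dm dm0 dm_ge0 dm_additive.

End density_measure.

Section product_integral.
Context (R : realType).
Local Notation leb := (@lebesgue_measure R).

Lemma emeasurable_prod d (T : measurableType d) (I : Type) (s : seq I)
    (g : I -> T -> \bar R) : (forall i, measurable_fun setT (g i)) ->
  measurable_fun setT (fun x => \prod_(i <- s) g i x)%E.
Proof.
move=> mg; elim: s => [|i s IH].
  under eq_fun do rewrite big_nil.
  exact: measurable_cst.
under eq_fun do rewrite big_cons.
exact: emeasurable_funM.
Qed.

Lemma lebN_prod N (g : 'I_N -> R -> \bar R) :
  (forall k, measurable_fun setT (g k)) -> (forall k x, 0 <= g k x)%E ->
  (\int[lebN]_x \prod_(k < N) g k (x k 0%R) = \prod_(k < N) \int[leb]_x g k x)%E.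
Proof.
elim: N g => [|N IH] g mg g0.
  under eq_integral do rewrite big_ord0.
  rewrite big_ord0 integral_cst // mul1e.
  rewrite (_ : setT = box (fun _ : 'I_0 => setT)); last by apply/seteqP; split.
  by rewrite [LHS]lebN_box // big_ord0.
have mprod M (h : 'I_M -> R -> \bar R) : (forall k, measurable_fun setT (h k)) ->
    measurable_fun setT (fun x : 'cV[R]_M => \prod_(k < M) h k (x k 0%R))%E.
  move=> mh; apply: emeasurable_prod => k.
  exact: (measurableT_comp (mh k) (measurable_coord k)).
rewrite (@lebNS_integral R N (fun x => \prod_(k < N.+1) g k (x k 0%R))%E); last 2 first.
- exact: mprod.
- by move=> x; apply: prode_ge0 => k _; exact: g0.
rewrite big_ord_recl /=.
transitivity (\int[lebN]_v ((\int[leb]_x g ord0 x) *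
    \prod_(k < N) g (lift ord0 k) (v k 0%R)))%E.
  apply: eq_integral => v _.
  rewrite -ge0_integralZr; last 4 first.
  - exact: measurableT.
  - exact: mg.
  - by move=> x _; exact: g0.
  - by apply: prode_ge0 => k _; exact: g0.
  apply: eq_integral => x _; rewrite big_ord_recl; congr (_ * _)%E.
    congr (g _ _); rewrite (_ : ord0 = lshift N (0 : 'I_1)); last exact: val_inj.
    by rewrite col_mxEu mxE eqxx.
  apply: eq_bigr => k _; congr (g _ _).
  by rewrite -rshift1 col_mxEd.
rewrite (@ge0_integralZl _ _ _ _ _ _
  (fun v : 'cV[R]_N => \prod_(k < N) g (lift ord0 k) (v k 0%R))%E); last 4 first.
- exact: measurableT.
- by apply: (mprod N (fun k => g (lift ord0 k))).
- by move=> v _; apply: prode_ge0 => k _; exact: g0.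
- by apply: integral_ge0.
by rewrite (IH (fun k => g (lift ord0 k))).
Qed.

End product_integral.

Section laws.
Context (R : realType) d (T : measurableType d) (P : probability T R).
Local Notation leb := (@lebesgue_measure R).

Definition vec_of N (X : 'I_N -> T -> R) (w : T) : 'cV[R]_N := \col_k X k w.

Lemma measurable_vec_of N (X : 'I_N -> T -> R) :
  (forall k, measurable_fun setT (X k)) -> measurable_fun setT (vec_of X).
Proof.
move=> mX; apply: measurable_fun_cvP => k; under eq_fun do rewrite mxE.
exact: mX.
Qed.

(** Independence in the form matched to [cv_measure_unique]: the joint law is prescribed on boxes
    only, and this determines it. *)
Definition box_independent N (X : 'I_N -> T -> R) : Prop :=
  forall A : 'I_N -> set R, (forall k, measurable (A k)) ->
    P (vec_of X @^-1` box A) = (\prod_(k < N) P (X k @^-1` A k))%E.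

Definition gauss_density N (s : 'I_N -> R) (x : 'cV[R]_N) : \bar R :=
  (\prod_(k < N) (normal_pdf 0 (s k) (x k 0))%R%:E)%E.

Lemma measurable_gauss_density N (s : 'I_N -> R) :
  measurable_fun setT (gauss_density s).
Proof.
apply: emeasurable_prod => k; apply/measurable_EFinP.
exact: (measurableT_comp (measurable_normal_pdf 0 (s k)) (measurable_coord k)).
Qed.

Lemma gauss_density_ge0 N (s : 'I_N -> R) x : (0 <= gauss_density s x)%E.
Proof. by apply: prode_ge0 => k _; rewrite lee_fin normal_pdf_ge0. Qed.

(** Both sides are measures in B. On a box, independence factors the left side and Tonelli factors
    the integral of the product density. *)
Lemma gaussian_law N (X : 'I_N -> T -> R) (s : 'I_N -> R) B :
  (forall k, measurable_fun setT (X k)) -> box_independent X ->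
  (forall k, is_gaussian0 P (s k) (X k)) -> measurable B ->
  P (vec_of X @^-1` B) = (\int[lebN]_(x in B) gauss_density s x)%E.
Proof.
move=> mX iX gX mB.
pose m1 := image_measure P (measurable_vec_of mX).
pose m2 : {measure set 'cV[R]_N -> \bar R} := density_measure lebN
  (measurable_gauss_density s) (gauss_density_ge0 s).
apply: (@cv_measure_unique R N m1 m2) mB => [A mA|n]; last first.
  apply: (@le_lt_trans _ _ 1%E); last exact: ltry.
  apply: probability_le1; rewrite -[X in measurable X]setTI.
  apply: measurable_vec_of => //; apply: measurable_box => k; exact: measurable_itv.
transitivity (\prod_(k < N) P (X k @^-1` A k))%E; first exact: iX.
rewrite /m2 /= /density_measure.
rewrite (eq_bigr (fun k => normal_prob 0 (s k) (A k))); last by move=> k _; exact: gX.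
rewrite integral_mkcond /normal_prob.
under eq_bigr do rewrite integral_mkcond.
rewrite -lebN_prod; last 2 first.
- move=> k.
  have mp : measurable_fun setT (fun x => (normal_pdf 0 (s k) x)%:E).
    by apply/measurable_EFinP; exact: measurable_normal_pdf.
  apply: (measurable_restrictT _ (mA k)).1.
  exact: measurable_funTS mp.
- move=> k x; apply: erestrict_ge0 => y _; by rewrite lee_fin normal_pdf_ge0.
apply: eq_integral => x _; rewrite patchE; case: ifPn => [/set_mem xA|xA].
  by apply: eq_bigr => k _; rewrite patchE mem_set //; exact: xA.
(* Off the box one restricted factor vanishes, and with it the whole product. *)
have [k xk] : exists k, ~ A k (x k 0).
  by apply/existsNP => h; move: xA; rewrite mem_set.
by rewrite (bigD1 k) //= patchE memNset // mul0e.
Qed.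

Definition joint N1 N2 (X : 'I_N1 -> T -> R) (Y : 'I_N2 -> T -> R)
    (k : 'I_(N1 + N2)) : T -> R :=
  match fintype.split k with inl i => X i | inr j => Y j end.

Lemma joint_lshift N1 N2 (X : 'I_N1 -> T -> R) (Y : 'I_N2 -> T -> R) i :
  joint X Y (lshift N2 i) = X i.
Proof. by rewrite /joint (unsplitK (inl i)). Qed.

Lemma joint_rshift N1 N2 (X : 'I_N1 -> T -> R) (Y : 'I_N2 -> T -> R) i :
  joint X Y (rshift N1 i) = Y i.
Proof. by rewrite /joint (unsplitK (inr i)). Qed.

Lemma vec_of_joint N1 N2 (X : 'I_N1 -> T -> R) (Y : 'I_N2 -> T -> R) w :
  vec_of (joint X Y) w = col_mx (vec_of X w) (vec_of Y w).
Proof.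
apply/colP => k; rewrite mxE; case: (split_ordP k) => j ->.
  by rewrite joint_lshift col_mxEu mxE.
by rewrite joint_rshift col_mxEd mxE.
Qed.

Lemma box_col_mx N1 N2 (A : 'I_(N1 + N2) -> set R) x y :
  box A (col_mx x y) =
  (box (fun k => A (lshift N2 k)) x /\ box (fun k => A (rshift N1 k)) y).
Proof.
apply/propext; split => [h|[h1 h2] k].
  by split=> k; [have := h (lshift N2 k); rewrite col_mxEu
                |have := h (rshift N1 k); rewrite col_mxEd].
by case: (split_ordP k) => j ->; rewrite ?col_mxEu ?col_mxEd.
Qed.

(** Leaving the coordinates of one vector unconstrained gives the independence within the other;
    comparing the full product with these two marginal products gives the independence between the
    vectors. *)
Lemma joint_box N1 N2 (X : 'I_N1 -> T -> R) (Y : 'I_N2 -> T -> R) :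
  box_independent (joint X Y) ->
  [/\ box_independent X, box_independent Y &
   forall A B, (forall k, measurable (A k)) -> (forall k, measurable (B k)) ->
    P (vec_of X @^-1` box A `&` vec_of Y @^-1` box B) =
    (P (vec_of X @^-1` box A) * P (vec_of Y @^-1` box B))%E].
Proof.
move=> iXY.
have gen A B : (forall k, measurable (A k)) -> (forall k, measurable (B k)) ->
    P (vec_of X @^-1` box A `&` vec_of Y @^-1` box B) =
    (\prod_(k < N1) P (X k @^-1` A k) * \prod_(k < N2) P (Y k @^-1` B k))%E.
  move=> mA mB.
  pose C (k : 'I_(N1 + N2)) := match fintype.split k with inl i => A i | inr j => B j end.
  have Cl i : C (lshift N2 i) = A i by rewrite /C (unsplitK (inl i)).
  have Cr i : C (rshift N1 i) = B i by rewrite /C (unsplitK (inr i)).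
  have mC k : measurable (C k) by rewrite /C; case: fintype.split.
  have := iXY C mC; rewrite big_split_ord /=.
  under eq_bigr do rewrite joint_lshift Cl.
  under [X in (_ * X)%E]eq_bigr do rewrite joint_rshift Cr.
  move=> <-; congr (P _); apply/seteqP; split => w /=;
    rewrite vec_of_joint box_col_mx => -[h1 h2]; split => k;
    by [have := h1 k; rewrite Cl|have := h2 k; rewrite Cr].
have T1 N (Z : 'I_N -> T -> R) : vec_of Z @^-1` box (fun=> setT) = setT.
  by apply/seteqP; split.
have p1 N (Z : 'I_N -> T -> R) : (\prod_(k < N) P (Z k @^-1` setT) = 1)%E.
  by rewrite big1 // => k _; rewrite preimage_setT probability_setT.
have iX : box_independent X.
  move=> A mA; have := gen A (fun=> setT) mA (fun=> measurableT).
  by rewrite T1 setIT p1 mule1.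
have iY : box_independent Y.
  move=> A mA; have := gen (fun=> setT) A (fun=> measurableT) mA.
  by rewrite T1 setTI p1 mul1e.
by split => // A B mA mB; rewrite gen // iX // iY.
Qed.

(** Independence makes the joint law the product of the marginal laws, and the product measure of E
    is the integral of its sections. This is conditioning on the first vector, without conditional
    expectations. *)
Lemma independent_integral N1 N2 (X : 'I_N1 -> T -> R) (Y : 'I_N2 -> T -> R)
    (E : set ('cV[R]_N1 * 'cV[R]_N2)) :
  (forall k, measurable_fun setT (X k)) -> (forall k, measurable_fun setT (Y k)) ->
  box_independent (joint X Y) -> measurable E ->
  measurable_fun setT (fun x => P [set w' | E (x, vec_of Y w')]) /\
  P [set w | E (vec_of X w, vec_of Y w)] =
  (\int[P]_w P [set w' | E (vec_of X w, vec_of Y w')])%E.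
Proof.
move=> mX mY iXY mE; have [iX iY gen] := joint_box iXY.
have mX' := measurable_vec_of mX; have mY' := measurable_vec_of mY.
have mXY : measurable_fun setT (fun w => col_mx (vec_of X w) (vec_of Y w)).
  exact: measurable_fun_col_mx.
have mcube N n : measurable (@cube_box R N n).
  by apply: measurable_box => k; exact: measurable_itv.
have fin N (f : T -> 'cV[R]_N) (mf : measurable_fun setT f) n :
    (image_measure P mf (@cube_box R N n) < +oo)%E.
  apply: (@le_lt_trans _ _ 1%E); last exact: ltry.
  by apply: probability_le1; rewrite -[X in measurable X]setTI; exact: (mf measurableT _ (mcube N n)).
pose PX : {sigma_finite_measure set 'cV[R]_N1 -> \bar R} :=
  box_sigma_finite_measure (fin _ _ mX').
pose PY : {sigma_finite_measure set 'cV[R]_N2 -> \bar R} :=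
  box_sigma_finite_measure (fin _ _ mY').
have mxs : measurable_fun setT (fun x => P [set w' | E (x, vec_of Y w')]).
  have := @measurable_fun_xsection _ _ _ _ R PY E mE.
  congr (measurable_fun _ _); apply/funext => x.
  change (P (vec_of Y @^-1` xsection E x) = P [set w' | E (x, vec_of Y w')]).
  congr (P _).
  by apply/seteqP; split => w /=; rewrite /xsection /= inE.
split => //.
(* The event is moved to the concatenated vector because uniqueness of measures is available on
   column vectors. *)
pose C : set 'cV[R]_(N1 + N2) := [set z | E (usubmx z, dsubmx z)].
have mC : measurable C.
  have mud : measurable_fun setT (fun z : 'cV[R]_(N1 + N2) => (usubmx z, dsubmx z)).
    apply: measurable_fun_pair; apply: measurable_fun_cvP => k.
      under eq_fun do rewrite mxE.
      exact: measurable_coord.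
    under eq_fun do rewrite mxE.
    exact: measurable_coord.
  by rewrite -[X in measurable X]setTI; exact: (mud measurableT _ mE).
transitivity (image_measure P mXY C).
  rewrite image_measureE; congr (P _); apply/seteqP.
  by split => w; rewrite /C /= col_mxKu col_mxKd.
transitivity (image_measure (PX \x PY)%E (@measurable_col_mx R N1 N2) C).
  apply: (cv_measure_unique _ (fin _ _ mXY)) mC => A mA.
  rewrite !image_measureE.
  rewrite (_ : (fun p => _) @^-1` box A = box (fun k => A (lshift N2 k)) `*`
     box (fun k => A (rshift N1 k))); last first.
    by apply/seteqP; split => -[x y] /=; rewrite box_col_mx.
  rewrite [RHS](product_measure1E PX PY); last 2 first.
  - exact: measurable_box.
  - exact: measurable_box.
  rewrite [RHS](_ : _ = (P (vec_of X @^-1` box (fun k => A (lshift N2 k))) *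
     P (vec_of Y @^-1` box (fun k => A (rshift N1 k))))%E) // -gen //.
  congr (P _); by apply/seteqP; split => w /=; rewrite box_col_mx.
transitivity ((PX \x PY)%E E).
  rewrite image_measureE; congr ((PX \x PY)%E _); apply/seteqP.
  by split => -[x y]; rewrite /C /= col_mxKu col_mxKd.
rewrite /product_measure1.
transitivity (\int[image_measure P mX']_x P [set w' | E (x, vec_of Y w')])%E.
  apply: eq_integral => x _.
  change (P (vec_of Y @^-1` xsection E x) = P [set w' | E (x, vec_of Y w')]).
  congr (P _).
  by apply/seteqP; split => w /=; rewrite /xsection /= inE.
by rewrite ge0_integral_image_measure.
Qed.

End laws.

(** * Realification of complex matrices *)

Section realification.
Context (R : realType).
Local Notation C := (R[i]).

Definition sqn N (x : 'cV[R]_N) : R := \sum_k (x k 0) ^+ 2.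

Definition realv m (x : 'cV[C]_m) : 'cV[R]_(m + m) :=
  col_mx (\col_k complex.Re (x k 0)) (\col_k complex.Im (x k 0)).

Definition rmx m n (A : 'M[C]_(m, n)) : 'M[R]_(m + m, n + n) :=
  block_mx (map_mx (@complex.Re R) A) (- map_mx (@complex.Im R) A)
           (map_mx (@complex.Im R) A) (map_mx (@complex.Re R) A).

Definition complexv m (x : 'cV[R]_(m + m)) : 'cV[C]_m :=
  \col_k (usubmx x k 0 +i* dsubmx x k 0)%C.

Lemma complexvK m : cancel (@complexv m) (@realv m).
Proof.
move=> x; rewrite -[RHS]vsubmxK; congr col_mx; apply/colP => k; by rewrite !mxE.
Qed.

Lemma realvK m : cancel (@realv m) (@complexv m).
Proof.
move=> x; apply/colP => k; rewrite mxE /realv col_mxKu col_mxKd !mxE.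
by case: (x k 0).
Qed.

Lemma realv_inj m : injective (@realv m).
Proof. exact: can_inj (@realvK m). Qed.

Lemma sqn_realv m (x : 'cV[C]_m) : sqn (realv x) = normsq x.
Proof.
rewrite /sqn big_split_ord /= /normsq -big_split /=; apply: eq_bigr => k _.
by rewrite col_mxEu col_mxEd !mxE.
Qed.

Lemma realvD m (x y : 'cV[C]_m) : realv (x + y) = realv x + realv y.
Proof.
rewrite /realv add_col_mx; congr col_mx; apply/colP => k; rewrite !mxE;
  by case: (x k 0) => ? ?; case: (y k 0).
Qed.

Lemma realvN m (x : 'cV[C]_m) : realv (- x) = - realv x.
Proof.
rewrite /realv opp_col_mx; congr col_mx; apply/colP => k; rewrite !mxE;
  by case: (x k 0).
Qed.

Lemma realvB m (x y : 'cV[C]_m) : realv (x - y) = realv x - realv y.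
Proof. by rewrite realvD realvN. Qed.

Lemma Re_sum (I : Type) (s : seq I) (f : I -> C) :
  complex.Re (\sum_(i <- s) f i) = \sum_(i <- s) complex.Re (f i).
Proof.
by elim: s => [|i s IH]; rewrite ?big_nil // !big_cons -IH; case: (f i) (\sum_(j <- s) _) => ? ? [].
Qed.

Lemma Im_sum (I : Type) (s : seq I) (f : I -> C) :
  complex.Im (\sum_(i <- s) f i) = \sum_(i <- s) complex.Im (f i).
Proof.
by elim: s => [|i s IH]; rewrite ?big_nil // !big_cons -IH; case: (f i) (\sum_(j <- s) _) => ? ? [].
Qed.

Lemma ReM (x y : C) : complex.Re (x * y) =
  complex.Re x * complex.Re y - complex.Im x * complex.Im y.
Proof. by case: x => ? ?; case: y. Qed.

Lemma ImM (x y : C) : complex.Im (x * y) =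
  complex.Re x * complex.Im y + complex.Im x * complex.Re y.
Proof. by case: x => ? ?; case: y. Qed.

Lemma realv_mulmx m n (A : 'M[C]_(m, n)) (x : 'cV[C]_n) :
  realv (A *m x) = rmx A *m realv x.
Proof.
rewrite /realv /rmx mul_block_col; congr col_mx; apply/colP => k; rewrite !mxE.
  rewrite Re_sum -big_split; apply: eq_bigr => j _.
  by rewrite ReM !mxE mulNr.
rewrite Im_sum -big_split; apply: eq_bigr => j _.
by rewrite ImM !mxE addrC.
Qed.

Lemma normsqE m (x : 'cV[C]_m) : (normsq x)%:C%C = (adjoint x *m x) 0 0.
Proof.
rewrite mxE /normsq rmorph_sum; apply: eq_bigr => k _ /=.
rewrite !mxE; case: (x k 0) => a b; apply/eqP; rewrite eq_complex /=.
by apply/andP; split; apply/eqP; ring.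
Qed.

Lemma adjointM m n p (A : 'M[C]_(m, n)) (B : 'M[C]_(n, p)) :
  adjoint (A *m B) = adjoint B *m adjoint A.
Proof. by rewrite /adjoint map_mxM trmx_mul. Qed.

Lemma adjointK m n (A : 'M[C]_(m, n)) : adjoint (adjoint A) = A.
Proof. by apply/matrixP => i j; rewrite !mxE conjcK. Qed.

(** The squared norm of A x is the quadratic form of the Gram matrix. This allows a tall channel
    matrix to be replaced by a square factor of its Gram matrix. *)
Lemma normsq_gram m n p (A : 'M[C]_(m, n)) (B : 'M[C]_(p, n)) x :
  adjoint A *m A = adjoint B *m B -> normsq (A *m x) = normsq (B *m x).
Proof.
move=> AB; suff : (normsq (A *m x))%:C%C = (normsq (B *m x))%:C%C by case.
by rewrite !normsqE !adjointM !mulmxA -(mulmxA (adjoint x)) AB !mulmxA.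
Qed.

Lemma det_adjoint n (A : 'M[C]_n) : \det (adjoint A) = conjc (\det A).
Proof. by rewrite /adjoint det_tr det_map_mx. Qed.

Lemma det_gram n (A : 'M[C]_n) :
  \det (adjoint A *m A) = (complex.Re (\det A) ^+ 2 + complex.Im (\det A) ^+ 2)%:C%C.
Proof.
rewrite det_mulmx det_adjoint; case: (\det A) => a b.
by apply/eqP; rewrite eq_complex /=; apply/andP; split; apply/eqP; ring.
Qed.

(** Over the complex numbers, conjugation by the unipotent block matrix with corner i makes [rmx A]
    block triangular, with diagonal blocks the conjugate of A and A. The determinant is therefore
    |det A|^2. *)
Lemma det_rmx n (A : 'M[C]_n) :
  \det (rmx A) = complex.Re (\det A) ^+ 2 + complex.Im (\det A) ^+ 2.
Proof.
suff : (\det (rmx A))%:C%C =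
    (complex.Re (\det A) ^+ 2 + complex.Im (\det A) ^+ 2)%:C%C by case.
rewrite -det_gram -[LHS](det_map_mx (real_complex R)).
pose i : C := (0 +i* 1)%C.
pose X : 'M[C]_n := map_mx (real_complex R) (map_mx (@complex.Re R) A).
pose Y : 'M[C]_n := map_mx (real_complex R) (map_mx (@complex.Im R) A).
have ii : i * i = -1.
  by apply/eqP; rewrite eq_complex /=; apply/andP; split; apply/eqP; ring.
have -> : map_mx (real_complex R) (rmx A) = block_mx X (- Y) Y X.
  by rewrite /rmx map_block_mx map_mxN.
have AE : A = X + i *: Y.
  apply/matrixP => a b; rewrite !mxE; case: (A a b) => u v.
  by apply/eqP; rewrite eq_complex /=; apply/andP; split; apply/eqP; ring.
have cAE : map_mx (@conjc R) A = X - i *: Y.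
  apply/matrixP => a b; rewrite !mxE; case: (A a b) => u v.
  by apply/eqP; rewrite eq_complex /=; apply/andP; split; apply/eqP; ring.
have <- : block_mx 1%:M (i%:M) 0 1%:M *m
    block_mx (X - i *: Y) 0 Y (X + i *: Y) *m
    block_mx 1%:M (- i%:M) 0 1%:M = block_mx X (- Y) Y X.
  rewrite !mulmx_block !mulmx1 !mul1mx !mulmx0 !mul0mx !addr0 !add0r.
  rewrite !mulmxN !mul_mx_scalar !mul_scalar_mx.
  rewrite subrK; congr block_mx; last by rewrite addrCA addNr addr0.
  by rewrite scalerDr scalerA ii scaleN1r addrA addNr add0r.
rewrite !det_mulmx !det_ublock det_lblock !det1 !mul1r mulr1.
by rewrite -AE -cAE det_map_mx det_adjoint.
Qed.

(* Gram-Schmidt on the rows of A^* writes A^* = X U with U U^* = 1; take T = X^*. *)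
Lemma gram_factor m n (A : 'M[C]_(m, n)) : (n <= m)%N ->
  exists T : 'M[C]_n, adjoint T *m T = adjoint A *m A.
Proof.
move=> nm; pose B := adjoint A.
have /submxP[X BX] := schmidt_sub B.
have /unitarymxP UU := schmidt_unitarymx B nm.
exists (adjoint X); rewrite adjointK -[A in RHS]adjointK -/B BX adjointM.
rewrite adjointM !adjointK mulmxA -(mulmxA X).
have -> : adjoint (schmidt B) = map_mx Num.conj (schmidt B)^T.
  by apply/matrixP => i j; rewrite !mxE.
by rewrite UU mulmx1.
Qed.

End realification.

(** * Orthogonal projection of a Gaussian integral *)

Section projection.
Context (R : realType).

Lemma sqnE N (x : 'cV[R]_N) : sqn x = (x^T *m x) 0 0.
Proof. by rewrite mxE /sqn; apply: eq_bigr => k _; rewrite mxE expr2. Qed.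

Lemma sqn_ge0 N (x : 'cV[R]_N) : 0 <= sqn x.
Proof. by apply: sumr_ge0 => k _; exact: sqr_ge0. Qed.

Lemma sqn_eq0 N (x : 'cV[R]_N) : sqn x = 0 -> x = 0.
Proof.
move/eqP; rewrite psumr_eq0 => [/allP x0|k _]; last exact: sqr_ge0.
apply/colP => k; rewrite mxE; apply/eqP.
by have := x0 k (mem_index_enum k); rewrite sqrf_eq0.
Qed.

Lemma sqnD_orth N (x y : 'cV[R]_N) : x^T *m y = 0 -> sqn (x + y) = sqn x + sqn y.
Proof.
move=> xy; have yx : y^T *m x = 0 by rewrite -[LHS]trmxK trmx_mul trmxK xy trmx0.
have tD : (x + y)^T = x^T + y^T by rewrite raddfD.
rewrite !sqnE tD mulmxDl !mulmxDr xy yx addr0 add0r.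
by rewrite mxE.
Qed.

Lemma measurable_sqn N : measurable_fun setT (@sqn R N).
Proof.
apply: measurable_sum => k; apply: measurable_funX; exact: measurable_coord.
Qed.

Lemma row_free_trmx N L (A : 'M[R]_(N, L)) :
  (forall u : 'cV_L, A *m u = 0 -> u = 0) -> row_free A^T.
Proof.
move=> Ainj; rewrite -kermx_eq0; apply/eqP/row_matrixP => i.
rewrite row0; apply: trmx_inj; rewrite trmx0; apply: Ainj.
by rewrite -{1}[A]trmxK -trmx_mul -row_mul mulmx_ker row0 trmx0.
Qed.

(** The columns of K are a basis of the orthogonal complement of the image of A, read off the left
    kernel of A; the equation on N is the rank theorem. *)
Lemma orth_completion N L (A : 'M[R]_(N, L)) :
  (forall u : 'cV_L, A *m u = 0 -> u = 0) ->
  exists p (K : 'M[R]_(N, p)), [/\ N = (L + p)%N, A^T *m K = 0 &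
    forall v : 'cV_p, K *m v = 0 -> v = 0].
Proof.
move=> Ainj; have rA : \rank A = L.
  by rewrite -mxrank_tr; apply/eqP; exact: row_free_trmx.
exists (\rank (kermx A)), ((row_base (kermx A))^T); split.
- by rewrite mxrank_ker -[in LHS](subnKC (rank_leq_row A)) rA.
- rewrite -trmx_mul -[RHS]trmx0; congr trmx; apply/eqP.
  by rewrite -/(_ *m A) -sub_kermx eq_row_base.
- move=> v Kv; apply: trmx_inj; rewrite trmx0.
  apply: (row_free_inj (row_base_free (kermx A))); rewrite mul0mx.
  by rewrite -[LHS]trmxK trmx_mul trmxK Kv trmx0.
Qed.

(* The constant C collects the Gaussian integral over the orthogonal complement
   of the image of A; it is identified later by normalisation. *)
Lemma gauss_projection N L (A : 'M[R]_(N, L)) (c : R) :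
  (forall u : 'cV_L, A *m u = 0 -> u = 0) ->
  exists C : \bar R, forall (E : set 'cV[R]_N) (U : set 'cV[R]_L),
    measurable E -> measurable U ->
    (forall u v, A^T *m v = 0 -> (E (A *m u + v) <-> U u)) ->
    (\int[lebN]_(z in E) (expR (- (c * sqn z)))%:E =
     C * \int[lebN]_(u in U) (expR (- (c * sqn (A *m u)%R)))%:E)%E.
Proof.
move=> Ainj; have [p [K [NE AK Kinj]]] := orth_completion Ainj.
subst N; pose B := row_mx A K : 'M[R]_(L + p).
have BE u v : B *m col_mx u v = A *m u + K *m v by rewrite mul_row_col.
have orth u v : (A *m u)^T *m (K *m v) = 0.
  by rewrite trmx_mul -mulmxA (mulmxA A^T) AK mul0mx mulmx0.
(* If A u + K v = 0, Pythagoras makes both squared norms vanish, and injectivity of A and of K gives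
   u = 0 and v = 0. *)
have uB : B \in unitmx.
  rewrite -unitmx_tr -row_free_unit; apply: row_free_trmx => x.
  rewrite -[x]vsubmxK BE => Bx.
  have : sqn (A *m usubmx x) + sqn (K *m dsubmx x) = 0.
    rewrite -sqnD_orth // Bx /sqn big1 // => k _; by rewrite mxE expr0n.
  move/eqP; rewrite paddr_eq0 ?sqn_ge0 // => /andP[/eqP/sqn_eq0/Ainj -> /eqP/sqn_eq0/Kinj ->].
  exact: col_mx0.
pose e N (x : 'cV[R]_N) : \bar R := (expR (- (c * sqn x)))%:E.
have e0 M (x : 'cV[R]_M) : (0 <= e M x)%E by rewrite lee_fin expR_ge0.
have me M : measurable_fun setT (e M).
  apply/measurable_EFinP; apply: measurableT_comp => //.
  by apply: measurableT_comp => //; apply: measurable_funM => //; exact: measurable_sqn.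
exists (`|(\det B)|%:E * \int[lebN]_v e _ (K *m v)%R)%E => E U mE mU EU.
rewrite integral_mkcond [X in (_ = _ * X)%E]integral_mkcond.
set f := (_ \_ E); set g := (_ \_ U).
have mf : measurable_fun setT f.
  by apply: (measurable_restrictT _ mE).1; exact: measurable_funTS (me _).
have mg : measurable_fun setT g.
  apply: (measurable_restrictT _ mU).1; apply: measurable_funTS.
  exact: (measurableT_comp (me _) (measurable_mulmx A)).
have f0 x : (0 <= f x)%E by apply: erestrict_ge0.
have g0 x : (0 <= g x)%E by apply: erestrict_ge0.
have dB : `|(\det B)| != 0 by rewrite normr_eq0 -unitfE -unitmxE.
have -> : (\int[lebN]_x f x = `|(\det B)|%:E * \int[lebN]_x f (B *m x)%R)%E.
  by rewrite lebN_mulmx // muleA -EFinM mulfV // mul1e.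
rewrite -muleA; congr (_ * _)%E.
have meK : measurable_fun setT (fun v => e _ (K *m v)%R).
  exact: (measurableT_comp (me _) (measurable_mulmx K)).
rewrite (@lebN_tonelli R L p (fun x => f (B *m x))) //; last exact: measurable_shear.
rewrite -ge0_integralZl //; last by apply: integral_ge0.
apply: eq_integral => u _.
rewrite muleC -ge0_integralZl //.
(* Membership in E depends on u alone and the exponential splits by Pythagoras, so the integrand is
   a product of a function of u and a function of v. *)
apply: eq_integral => v _; rewrite BE /f /g !patchE.
have KE : E (A *m u + K *m v) <-> U u by apply: EU; rewrite mulmxA AK mul0mx.
have [uU|uU] := pselect (U u).
  rewrite !mem_set //; last by apply/KE.
  by rewrite sqnD_orth // mulrDr opprD expRD EFinM.
by rewrite !memNset //; [rewrite mul0e|move/KE].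
Qed.

End projection.

(** * Volume of balls *)

Section gamma.
Context (R : realType).
Local Notation leb := (@lebesgue_measure R).

(** The sum of l!/j! X^j over j <= l. It solves p - p' = X^l, so that -p(x) exp(-x) is an
    antiderivative of x^l exp(-x); its value l! at 0 is the Gamma integral. *)
Fixpoint gamma_poly (l : nat) : {poly R} :=
  if l is k.+1 then 'X^(k.+1) + k.+1%:R *: gamma_poly k else 1.

Lemma gamma_poly_deriv l : gamma_poly l - (gamma_poly l)^`() = 'X^l.
Proof.
elim: l => [|l IH] /=; first by rewrite derivC subr0 expr0.
rewrite derivD derivXn derivZ /= opprD addrACA -scalerBr IH scaler_nat.
by rewrite subrK.
Qed.

Lemma gamma_poly0 l : (gamma_poly l).[0] = (l`!)%:R.
Proof.
elim: l => [|l IH] /=; first by rewrite hornerC.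
by rewrite hornerD hornerXn expr0n /= add0r hornerZ IH factS natrM.
Qed.

(** The exponential dominates x^(n+1)/(n+1)!, one power more than needed, which leaves a bound of
    order 1/x. *)
Lemma cvg_XnexpN n : x ^+ n * expR (- x) @[x --> +oo%R] --> (0 : R).
Proof.
apply: (squeeze_cvgr (f := cst 0) (h := fun x : R => (n.+1)`!%:R / x)).
- near=> x.
  have x0 : 0 < x by near: x; exact: nbhs_pinfty_gt.
  apply/andP; split; first by rewrite mulr_ge0 ?expR_ge0 ?exprn_ge0 ?ltW.
  rewrite expRN ler_pdivlMr // mulrAC -exprSr ler_pdivrMr ?expR_gt0 //.
  rewrite mulrC -ler_pdivrMr ?ltr0n ?fact_gt0 //.
  by apply: le_trans (expR_ge1Dxn n (ltW x0)); rewrite lerDr.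
- exact: cvg_cst.
- rewrite -[X in _ --> X](mulr0 (n.+1)`!%:R).
  apply: cvgMr; apply/gtr0_cvgV0; last exact: cvg_id.
  by near=> x; near: x; exact: nbhs_pinfty_gt.
Unshelve. all: by end_near. Qed.

Lemma cvg_gamma_poly l : (gamma_poly l).[x] * expR (- x) @[x --> +oo%R] --> (0 : R).
Proof.
elim: l => [|l IH] /=.
  under eq_cvg do rewrite hornerC mul1r.
  exact: cvgr_expR.
have h : (x ^+ l.+1 * expR (- x) + l.+1%:R * ((gamma_poly l).[x] * expR (- x)))
    @[x --> +oo%R] --> (0 + l.+1%:R * 0 : R).
  by apply: cvgD; [exact: cvg_XnexpN|apply: cvgMr].
rewrite mulr0 addr0 in h; apply: cvg_trans h; apply: near_eq_cvg.
by near=> x; rewrite hornerD hornerXn hornerZ mulrDl -mulrA.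
Unshelve. all: by end_near. Qed.

Lemma is_derive_gamma_poly l (x : R) :
  is_derive x 1 (fun x : R => - ((gamma_poly l).[x] * expR (- x)))
    (x ^+ l * expR (- x)).
Proof.
have h1 : is_derive x (1 : R) (horner (gamma_poly l)) (gamma_poly l)^`().[x].
  exact: is_derive_poly.
have h2 : is_derive x (1 : R) (fun x : R => expR (- x)) (- expR (- x)).
  have := @is_derive1_comp R expR -%R x (expR (- x)) (-1) _ _.
  by rewrite mulrN1; apply.
have h := is_deriveN (is_deriveM h1 h2).
apply: (is_derive_eq h); rewrite -hornerXn -gamma_poly_deriv hornerD hornerN.
rewrite /GRing.scale /=; ring.
Qed.

Lemma integral_gamma l :
  (\int[leb]_(x in `[0%R, +oo[) (x ^+ l * expR (- x))%:E = (l`!)%:R%:E)%E.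
Proof.
pose F := fun x : R => - ((gamma_poly l).[x] * expR (- x)).
have cF x : {for x, continuous F}.
  apply: differentiable_continuous; apply/derivable1_diffP.
  by have [] := is_derive_gamma_poly l x.
rewrite (@ge0_continuous_FTC2y R _ F 0 0).
- by rewrite /F oppr0 expR0 mulr1 gamma_poly0 EFinN sub0e oppeK.
- by move=> x x0; rewrite mulr_ge0 ?expR_ge0 ?exprn_ge0.
- apply: continuous_subspaceT => x; apply: cvgM.
    exact: exprn_continuous.
  by apply: continuous_comp; [exact: opp_continuous|exact: continuous_expR].
- rewrite -oppr0; apply: cvgN; exact: cvg_gamma_poly.
- by move=> x _; have [] := is_derive_gamma_poly l x.
- by apply: cvg_at_right_filter; exact: cF.
- move=> x _; rewrite derive1E; have [_ <-] := is_derive_gamma_poly l x; by [].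
Qed.

Lemma integral_expN_tail (a : R) :
  (\int[leb]_(x in `]a, +oo[) (expR (- x))%:E = (expR (- a))%:E)%E.
Proof.
rewrite integral_itv_obnd_cbnd; last first.
  apply/measurable_EFinP/measurable_funTS; apply: measurableT_comp => //.
have d (x : R) : is_derive x (1 : R) (fun x : R => - expR (- x)) (expR (- x)).
  have := is_derive_gamma_poly 0 x; rewrite expr0 mul1r.
  congr is_derive; apply/funext => y /=; by rewrite hornerC mul1r.
rewrite (@ge0_continuous_FTC2y R _ (fun x : R => - expR (- x)) a 0).
- by rewrite EFinN sub0e oppeK.
- by move=> x x0; rewrite expR_ge0.
- apply: continuous_subspaceT => x.
  by apply: continuous_comp; [exact: opp_continuous|exact: continuous_expR].
- rewrite -oppr0; apply: cvgN; exact: cvgr_expR.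
- by move=> x _; have [] := d x.
- apply: cvg_at_right_filter.
  have ca : {for a, continuous (fun x : R => - expR (- x))}.
    apply: differentiable_continuous; apply/derivable1_diffP.
    by have [] := d a.
  exact: ca.
- by move=> x _; rewrite derive1E; have [_ <-] := d x.
Qed.

End gamma.

Section ball.
Context (R : realType).
Local Notation leb := (@lebesgue_measure R).

Lemma measurable_ball N (s : R) : measurable [set x : 'cV[R]_N | sqn x < s].
Proof.
rewrite (_ : mkset _ = (@sqn R N) @^-1` `]-oo, s[).
  by rewrite -[X in measurable X]setTI; apply: measurable_sqn => //; exact: measurable_itv.
by apply/seteqP; split => x /=; rewrite in_itv.
Qed.

Lemma sqnZ N (a : R) (x : 'cV[R]_N) : sqn (a *: x) = a ^+ 2 * sqn x.
Proof. by rewrite /sqn mulr_sumr; apply: eq_bigr => k _; rewrite mxE exprMn. Qed.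

(* sqrt(s) times the identity has determinant s^l in dimension 2l. *)
Lemma ball_scale l (s : R) : 0 < s ->
  lebN [set x : 'cV[R]_(l + l) | sqn x < s] =
  ((s ^+ l)%:E * lebN [set x : 'cV[R]_(l + l) | (sqn x < 1)%R])%E.
Proof.
move=> s0; pose A : 'M[R]_(l + l) := (Num.sqrt s)%:M.
have dA : \det A = s ^+ l by rewrite det_scalar exprD -exprMn -expr2 sqr_sqrtr ?ltW.
have sl0 : 0 < s ^+ l by rewrite exprn_gt0.
have uA : A \in unitmx by rewrite unitmxE dA unitfE gt_eqF.
pose B := [set x : 'cV[R]_(l + l) | sqn x < s].
have mB : measurable B by exact: measurable_ball.
have mI : measurable_fun setT (fun x => (\1_B x)%:E : \bar R).
  by apply/measurable_EFinP; exact: measurable_indic.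
have h := @lebN_mulmx R _ A (fun x => (\1_B x)%:E) uA mI _.
transitivity ((s ^+ l)%:E * \int[lebN]_x (\1_B (A *m x))%:E)%E.
  rewrite h; last by move=> x; rewrite lee_fin.
  rewrite integral_indic // setIT.
  by rewrite dA gtr0_norm // muleA -EFinM mulfV ?gt_eqF // mul1e.
congr (_ * _)%E; rewrite -[X in lebN X]setIT -integral_indic //; last exact: measurable_ball.
apply: eq_integral => x _; congr EFin; rewrite !indicE; congr ((nat_of_bool _)%:R).
apply/idP/idP; rewrite !inE /B /= mul_scalar_mx sqnZ sqr_sqrtr ?ltW //.
  by rewrite -{2}[s]mulr1 ltr_pM2l.
by rewrite -{2}[s]mulr1 ltr_pM2l.
Qed.

Lemma integral_gauss_sqn l :
  (\int[lebN]_x (expR (- sqn (x : 'cV[R]_(l + l))))%:E = (pi ^+ l)%:E)%E.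
Proof.
transitivity (\int[@lebN R (l + l)]_x \prod_(k < l + l) (gauss_fun (x k 0%R))%:E)%E.
  apply: eq_integral => x _; rewrite /sqn -sumrN expR_sum /=.
  by rewrite prodEFin.
rewrite (@lebN_prod R (l + l) (fun _ y => (gauss_fun y)%:E)).
- rewrite integralT_gauss prodEFin prodr_const card_ord exprD -exprMn -expr2.
  by rewrite sqr_sqrtr ?pi_ge0.
- by move=> k; apply/measurable_EFinP; exact: measurable_gauss_fun.
- by move=> k x; rewrite lee_fin gauss_fun_ge0.
Qed.

(* Layer cake: pi^l is the integral of exp(-|x|^2) = int_{t > |x|^2} exp(-t) dt,
   hence vol(unit ball) * int_0^oo t^l exp(-t) dt. *)
Lemma ball_volume l (s : R) : 0 < s ->
  lebN [set x : 'cV[R]_(l + l) | sqn x < s] = (Vball R l * s ^+ l)%:E.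
Proof.
move=> s0; rewrite ball_scale //.
set V := lebN _.
suff VE : (V = (Vball R l)%:E)%E by rewrite VE -EFinM mulrC.
have key : ((pi ^+ l)%:E = V * ((l`!)%:R : R)%:E)%E.
  rewrite -integral_gauss_sqn.
  pose D := [set p : 'cV[R]_(l + l) * R | sqn p.1 < p.2].
  have mD : measurable D.
    have md : measurable_fun setT (fun p : 'cV[R]_(l + l) * R => p.2 - sqn p.1).
      apply: measurable_funB => //.
      by apply: (measurableT_comp (@measurable_sqn R _)).
    rewrite (_ : D = (fun p : 'cV[R]_(l + l) * R => p.2 - sqn p.1) @^-1` `]0, +oo[).
      rewrite -[X in measurable X]setTI; apply: md => //; exact: measurable_itv.
    by apply/seteqP; split => p /=; rewrite in_itv /= andbT subr_gt0.
  pose f (p : 'cV[R]_(l + l) * R) : \bar R := (\1_D p * expR (- p.2))%:E.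
  have mf : measurable_fun setT f.
    apply/measurable_EFinP; apply: measurable_funM => //.
    by apply: measurableT_comp => //; apply: measurableT_comp.
  have f0 p : (0 <= f p)%E by rewrite lee_fin mulr_ge0 ?expR_ge0.
  transitivity (\int[lebN]_x \int[leb]_t f (x, t))%E.
    apply: eq_integral => x _; rewrite -integral_expN_tail integral_mkcond.
    apply: eq_integral => t _; rewrite patchE /f /= indicE.
    have [xt|xt] := ltP (sqn x) t.
      have tI : `]sqn x, +oo[%classic t by rewrite /= in_itv /= xt.
      by rewrite !mem_set // mul1r.
    have tI : ~ `]sqn x, +oo[%classic t by rewrite /= in_itv /= ltNge xt.
    rewrite !memNset ?mul0r // /D /=; by apply/negP; rewrite -leNgt.
  rewrite (@fubini_tonelli _ _ _ _ _ lebN leb f mf f0).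
  rewrite -(integral_gamma R l) -integral_itv_obnd_cbnd; last first.
    apply/measurable_EFinP/measurable_funTS; apply: measurable_funM => //.
    exact: measurableT_comp.
  rewrite [in RHS]integral_mkcond -ge0_integralZl; last 4 first.
  - exact: measurableT.
  - apply: (measurable_restrictT _ _).1; first exact: measurable_itv.
    apply/measurable_EFinP/measurable_funTS; apply: measurable_funM => //.
    exact: measurableT_comp.
  - move=> t _; apply: erestrict_ge0 => y /=; rewrite in_itv /= andbT => y0.
    by rewrite lee_fin mulr_ge0 ?expR_ge0 ?exprn_ge0 ?ltW.
  - exact: measure_ge0.
  apply: eq_integral => t _.
  transitivity ((expR (- t))%:E * lebN [set x : 'cV[R]_(l + l) | (sqn x < t)%R])%E.
    rewrite -[X in lebN X]setIT -integral_indic //; last exact: measurable_ball.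
    rewrite -ge0_integralZl; last 4 first.
    - exact: measurableT.
    - by apply/measurable_EFinP; apply: measurable_indic; exact: measurable_ball.
    - by move=> x _; rewrite lee_fin.
    - by rewrite lee_fin expR_ge0.
    apply: eq_integral => x _; rewrite /f mulrC EFinM; congr (_ * (_)%:E)%E.
  (* For t <= 0 the ball is empty, in agreement with the restriction of the Gamma integral to
     positive t. *)
  rewrite patchE; have [t0|t0] := ltP 0 t.
    rewrite mem_set /=; last by rewrite in_itv /= t0.
    by rewrite ball_scale // -/V muleA -EFinM muleC mulrC.
  rewrite memNset /=; last by rewrite in_itv /= ltNge t0.
  rewrite mule0 (_ : mkset _ = set0) ?measure0 ?mule0 //.
  apply/seteqP; split => // x /= xt.
  by have := le_lt_trans (sqn_ge0 x) xt; rewrite ltNge t0.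
have l0 : (l`!)%:R != 0 :> R by rewrite pnatr_eq0 -lt0n fact_gt0.
(* Dividing by l! needs V finite: an infinite V would make the finite number pi^l infinite. *)
have fV : V \is a fin_num.
  have V0 : (0 <= V)%E by exact: measure_ge0.
  rewrite ge0_fin_numE // ltey; apply/eqP => Voo; move: key; rewrite Voo.
  by rewrite gt0_mulye // lte_fin ltr0n fact_gt0.
rewrite -(fineK fV) -EFinM in key; case: key => key.
by rewrite -(fineK fV) /Vball key mulfK.
Qed.

End ball.

(** * Cells and the tangent inequality *)

Lemma countable_bigcap_measurable d (T : measurableType d) (I : Type) (A : set I)
    (F : I -> set T) :
  countable A -> (forall i, A i -> measurable (F i)) ->
  measurable (\bigcap_(i in A) F i).
Proof.
move=> /countable_injP[f finj] mF.
pose G n := [set x | forall i, A i -> f i = n -> F i x].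
rewrite (_ : \bigcap_(i in A) F i = \bigcap_n G n); last first.
  apply/seteqP; split => x h; first by move=> n _ i Ai _; exact: h.
  by move=> i Ai; exact: (h (f i)).
apply: bigcap_measurableType => n _.
have [[i [Ai fi]]|nex] := pselect (exists i, A i /\ f i = n).
  rewrite (_ : G n = F i); first exact: mF.
  apply/seteqP; split => x h; first exact: h.
  move=> j Aj fj; suff -> : j = i by [].
  by apply: finj; rewrite ?inE // fj.
rewrite (_ : G n = setT) //; apply/seteqP; split => // x _ i Ai fi.
by exfalso; apply: nex; exists i.
Qed.

Section cells.
Context (R : realType) (N L : nat) (A : 'M[R]_(N, L)).
Hypothesis Ainj : forall u : 'cV_L, A *m u = 0 -> u = 0.
Local Notation q u := (sqn (A *m u)).

Lemma measurable_q : measurable_fun setT (fun u : 'cV[R]_L => q u).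
Proof. exact: (measurableT_comp (@measurable_sqn R N) (measurable_mulmx A)). Qed.

(* The Voronoi cell of A s in A S, translated to 0 and pulled back by A. *)
Definition cell (S : set 'cV[R]_L) (s : 'cV[R]_L) : set 'cV[R]_L :=
  [set u | forall s', S s' -> q u <= q (u - (s' - s))].

Lemma measurable_cell S s : countable S -> measurable (cell S s).
Proof.
move=> cS; rewrite (_ : cell S s =
  \bigcap_(s' in S) [set u | q u <= q (u - (s' - s))]); last first.
  by apply/seteqP; split => u h s' Ss'; exact: h.
apply: countable_bigcap_measurable => // s' _.
rewrite -[X in measurable X]setTI; apply: measurable_fun_le => //.
  exact: measurable_q.
exact: (measurableT_comp measurable_q (measurable_addv _)).
Qed.

(** The parameter is half the side, whereas that of [cube] is the side. This accounts for the
    factors 2 and 1/2 where the two meet. *)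
Definition opencube M (a : R) : set 'cV[R]_M := [set x | forall k, `|x k 0| < a].

Lemma opencube_box M a : @opencube M a = box (fun _ => `]- a, a[%classic).
Proof.
by apply/seteqP; split => x /= h k; have := h k; rewrite /= in_itv /= ltr_norml.
Qed.

Lemma measurable_opencube M a : measurable (@opencube M a).
Proof. by rewrite opencube_box; apply: measurable_box => k; exact: measurable_itv. Qed.

Lemma lebN_opencube M (a : R) : 0 < a -> lebN (@opencube M a) = ((2 * a) ^+ M)%:E.
Proof.
move=> a0; rewrite opencube_box lebN_box; last by move=> k; exact: measurable_itv.
rewrite (eq_bigr (fun _ => (2 * a)%:E)).
  by rewrite prodEFin prodr_const card_ord.
move=> k _; rewrite lebesgue_measure_itv /= lte_fin gt0_cp // -EFinB.
by congr EFin; ring.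
Qed.

Definition shifted (s : 'cV[R]_L) (B : set 'cV[R]_L) : set 'cV[R]_L :=
  [set x | B (x - s)].

Lemma measurable_shifted s B : measurable B -> measurable (shifted s B).
Proof.
by move=> mB; rewrite -[X in measurable X]setTI; exact: (measurable_addv (- s)).
Qed.

Lemma lebN_shifted s B : measurable B -> lebN (shifted s B) = lebN B.
Proof.
move=> mB.
have ind C : measurable C -> lebN C = (\int[@lebN R L]_x (\1_C x)%:E)%E.
  by move=> mC; rewrite integral_indic // setIT.
rewrite !ind //; last exact: measurable_shifted.
rewrite -(@lebN_shift R L (- s) (fun x => (\1_B x)%:E)) //.
by apply/measurable_EFinP; exact: measurable_indic.
Qed.

(** Along a line directed by v = s' - s the difference of the two squared distances is affine with
    slope 2 |A v|^2, which is nonzero by injectivity of A. Each such line meets the bisector in one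
    point. *)
Lemma bisector_null (s s' : 'cV[R]_L) : s != s' ->
  lebN [set x | q (x - s) = q (x - s')] = 0%E.
Proof.
move=> ss'; set Z := mkset _.
have mZ : measurable Z.
  have m1 s0 : measurable_fun setT (fun x : 'cV[R]_L => q (x - s0)).
    exact: (measurableT_comp measurable_q (measurable_addv _)).
  rewrite (_ : Z = (setT `&` [set x | q (x - s) <= q (x - s')]) `&`
                   (setT `&` [set x | q (x - s') <= q (x - s)])).
    by apply: measurableI; apply: measurable_fun_le.
  rewrite !setTI; apply/seteqP; split => x /=; first by move=> ->.
  by move=> [h1 h2]; apply/eqP; rewrite eq_le h1 h2.
pose v := s' - s.
have v0 : sqn (A *m v) != 0.
  apply/negP => /eqP/sqn_eq0/Ainj/eqP; rewrite subr_eq0 => /eqP e.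
  by rewrite e eqxx in ss'.
apply: (lebN_null_lines (v := v)) => // x.
pose y := A *m (x - s); pose w := A *m v.
pose dt := \sum_k y k 0 * w k 0.
rewrite (_ : mkset _ = [set 1 / 2 - dt / sqn w]); first exact: lebesgue_measure_set1.
have E c : q (x + c *: v - s) - q (x + c *: v - s') = 2 * dt + 2 * c * sqn w - sqn w.
  have -> : x + c *: v - s' = x + c *: v - s - v.
    by rewrite /v opprB addrA subrK.
  have -> : A *m (x + c *: v - s - v) = (y + c *: w) - w.
    by rewrite mulmxBr addrAC mulmxDr -scalemxAr.
  rewrite addrAC mulmxDr -scalemxAr -/y -/w.
  rewrite /dt /sqn !mulr_sumr -!sumrB -!big_split /= -!sumrB.
  by apply: eq_bigr => k _; rewrite !mxE; ring.
apply/seteqP; split => c /=.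
  rewrite /Z /= => /eqP; rewrite -subr_eq0 E => /eqP h.
  have -> : dt = sqn w / 2 - c * sqn w by lra.
  by field.
move=> ->; rewrite /Z /=; apply/eqP; rewrite -subr_eq0 E; apply/eqP.
by field.
Qed.

Lemma measurable_shifted_cell S s (B : set 'cV[R]_L) : countable S -> measurable B ->
  measurable (shifted s (cell S s `&` B)).
Proof.
by move=> cS mB; apply: measurable_shifted; apply: measurableI => //; exact: measurable_cell.
Qed.

(** Cells are closed, ties counting as correct decisions, so two of them may meet; a common point is
    equidistant from the two codewords. *)
Lemma overlap_null S s s' (B : set 'cV[R]_L) : countable S -> measurable B ->
  S s -> S s' -> s != s' ->
  lebN (shifted s (cell S s `&` B) `&` shifted s' (cell S s' `&` B)) = 0%E.
Proof.
move=> cS mB Ss Ss' ss'.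
apply: (subset_measure0 _ _ _ (bisector_null ss')).
- by apply: measurableI; exact: measurable_shifted_cell.
- have m1 s0 : measurable_fun setT (fun x : 'cV[R]_L => q (x - s0)).
    exact: (measurableT_comp measurable_q (measurable_addv _)).
  rewrite (_ : mkset _ = (setT `&` [set x | q (x - s) <= q (x - s')]) `&`
                   (setT `&` [set x | q (x - s') <= q (x - s)])).
    by apply: measurableI; apply: measurable_fun_le.
  rewrite !setTI; apply/seteqP; split => x /=; first by move=> ->.
  by move=> [h1 h2]; apply/eqP; rewrite eq_le h1 h2.
- move=> x [[/= c1 _] [/= c2 _]]; apply/eqP; rewrite eq_le.
  have E a b : x - a - (b - a) = x - b by rewrite opprB addrA subrK.
  by apply/andP; split; [have := c1 _ Ss'|have := c2 _ Ss]; rewrite E.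
Qed.

Lemma cell_packing S (F : seq 'cV[R]_L) (a rho : R) :
  0 < rho -> countable S -> uniq F ->
  (forall s, s \in F -> S s /\ opencube a s) ->
  (\sum_(s <- F) lebN (cell S s `&` @opencube L rho) <= lebN (@opencube L (a + rho)))%E.
Proof.
move=> rho0 cS uF FS; pose V s := shifted s (cell S s `&` @opencube L rho).
have mV s : measurable (V s) by apply: measurable_shifted_cell => //; exact: measurable_opencube.
have mU G : measurable (\big[setU/set0]_(s <- G) V s).
  by apply: bigsetU_measurable => s _; exact: mV.
have -> : (\sum_(s <- F) lebN (cell S s `&` @opencube L rho) =
           lebN (\big[setU/set0]_(s <- F) V s))%E.
  elim: F uF FS => [|s F IH] /=; first by rewrite !big_nil measure0.
  move=> /andP[sF uF] FS; rewrite !big_cons IH //; last first.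
    by move=> t tF; apply: FS; rewrite inE tF orbT.
  have [Ss _] := FS s (mem_head _ _).
  have Ve : lebN (cell S s `&` @opencube L rho) = lebN (V s).
    rewrite lebN_shifted //; apply: measurableI; first exact: measurable_cell.
    exact: measurable_opencube.
  have Vint : lebN (V s `&` \big[setU/set0]_(t <- F) V t) = 0%E.
    elim: F {uF IH} sF FS => [|t F IH] /=; first by rewrite big_nil setI0 measure0.
    rewrite inE negb_or => /andP[st sF] FS; rewrite big_cons setIUr.
    apply: null_set_setU.
    - exact: measurableI.
    - exact: measurableI.
    - have [St _] := FS t ltac:(by rewrite !inE eqxx orbT).
      by apply: overlap_null => //; exact: measurable_opencube.
    - apply: IH => // u; rewrite inE => /orP[/eqP ->|uF]; apply: FS.
        by rewrite inE eqxx.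
      by rewrite !inE uF !orbT.
  (* Inclusion-exclusion subtracts the overlap, which calls for a finite measure; truncation to the
     cube provides it. *)
  have Vfin : (lebN (V s) < +oo)%E.
    rewrite -Ve; apply: (@le_lt_trans _ _ (lebN (@opencube L rho))).
      apply: le_measure; rewrite ?inE; last exact: subIsetr.
        by apply: measurableI; [exact: measurable_cell|exact: measurable_opencube].
      exact: measurable_opencube.
    by rewrite lebN_opencube // ltry.
  by rewrite Ve [RHS](measureUfinl (mV s) (mU F) Vfin) [X in (_ - X)%E]Vint sube0.
apply: le_measure; rewrite ?inE; [exact: mU|exact: measurable_opencube|].
rewrite big_seq; elim/big_ind: _ => [//|B C BE CE x [/BE|/CE]//|s sF x [_ xs] k].
have [_ sa] := FS s sF.
have -> : x k 0 = s k 0 + (x - s) k 0 by rewrite !mxE addrCA subrr addr0.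
by apply: (le_lt_trans (ler_normD _ _)); apply: ltrD; [exact: sa|exact: xs].
Qed.

End cells.

Section tangent.
Context d (T : measurableType d) (R : realType) (m : {measure set T -> \bar R}).
Variables (q : T -> R) (h : R -> R) (r2 : R).
Hypotheses (mq : measurable_fun setT q) (mh : measurable_fun setT (h \o q)).
Hypotheses (h0 : forall y, 0 <= h y) (hdec : forall x y, x <= y -> h y <= h x).

(** With E the sublevel set, the pointwise inequality (h (q x) - h r2) (1_E - 1_W) >= 0 is
    integrated: on E both factors are nonnegative, off E both are nonpositive. Terms are arranged as
    sums on both sides because extended reals do not cancel. *)
Lemma tangent_ineq (W : set T) : measurable W ->
  (\int[m]_(x in W) (h (q x))%:E + (h r2)%:E * m [set x | (q x < r2)%R] <=
   \int[m]_(x in [set x | (q x < r2)%R]) (h (q x))%:E + (h r2)%:E * m W)%E.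
Proof.
move=> mW; set E := mkset _.
have mE : measurable E.
  rewrite (_ : E = q @^-1` `]-oo, r2[).
    by rewrite -[X in measurable X]setTI; apply: mq => //; exact: measurable_itv.
  by apply/seteqP; split => x /=; rewrite in_itv.
have ind C : measurable C -> ((h r2)%:E * m C = \int[m]_x (h r2 * \1_C x)%:E)%E.
  move=> mC; under eq_integral do rewrite EFinM.
  rewrite ge0_integralZl //.
  - by rewrite integral_indic // setIT.
  - by apply/measurable_EFinP; exact: measurable_indic.
  - by rewrite lee_fin.
have indq C : measurable C ->
    (\int[m]_(x in C) (h (q x))%:E = \int[m]_x (h (q x) * \1_C x)%:E)%E.
  move=> mC; rewrite integral_mkcond; apply: eq_integral => x _.
  rewrite patchE indicE; case: ifPn => xC; first by rewrite mulr1.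
  by rewrite mulr0.
have mhC (f : T -> R) C : measurable C -> measurable_fun setT f ->
    measurable_fun setT (fun x => (f x * \1_C x)%:E).
  by move=> mC mf; apply/measurable_EFinP; apply: measurable_funM.
have mr2 : measurable_fun setT (fun _ : T => h r2) by exact: measurable_cst.
have ge0 (f : T -> R) C x : (forall x, 0 <= f x) -> (0 <= (f x * \1_C x)%:E)%E.
  by move=> f0; rewrite lee_fin mulr_ge0.
rewrite !ind // !indq // -!ge0_integralD //; last 8 first.
- by move=> x _; apply: (ge0 (h \o q)) => y; exact: h0.
- exact: (mhC (h \o q)).
- by move=> x _; apply: (ge0 (fun=> h r2)).
- exact: (mhC (fun=> h r2)).
- by move=> x _; apply: (ge0 (h \o q)) => y; exact: h0.
- exact: (mhC (h \o q)).
- by move=> x _; apply: (ge0 (fun=> h r2)).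
- exact: (mhC (fun=> h r2)).
apply: ge0_le_integral => //.
- by move=> x _; apply: adde_ge0; [apply: (ge0 (h \o q)) => y; exact: h0|apply: (ge0 (fun=> h r2))].
- by apply: emeasurable_funD; [exact: (mhC (h \o q))|exact: (mhC (fun=> h r2))].
- by apply: emeasurable_funD; [exact: (mhC (h \o q))|exact: (mhC (fun=> h r2))].
move=> x _; rewrite -!EFinD lee_fin !indicE.
have [xE|xE] := ltP (q x) r2.
  have -> : x \in E by rewrite inE.
  have := hdec (ltW xE); case: (x \in W); rewrite /=; lra.
have -> : x \in E = false by apply/negP; rewrite inE /E /= => /lt_le_trans /(_ xE); rewrite ltxx.
have := hdec xE; case: (x \in W); rewrite /=; lra.
Qed.

End tangent.

(** * Finite counts and upper limits *)

Section finite_counts.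
Context (R : realType) (U : choiceType).

Lemma ecard_lty_finite (A : set U) : (@ecard R U A < +oo)%E -> finite_set A.
Proof.
move=> Aoo; apply: contrapT => Ainf.
have A0 : (0 <= @ecard R U A)%E by apply: esum_ge0.
have fA : @ecard R U A \is a fin_num by rewrite ge0_fin_numE.
have [B BA Bn] := infinite_set_fset (Num.truncn (fine (@ecard R U A))).+1 Ainf.
have : (((size (finmap.enum_fset B))%:R : R)%:E <= @ecard R U A)%E.
  apply: esum_ge; exists [set` finmap.enum_fset B].
    by split; [apply/finite_seqP; exists (finmap.enum_fset B)|exact: BA].
  rewrite -fsbig_seq ?finmap.fset_uniq //= sumEFin big_const_seq count_predT iter_addr_0 //=.
rewrite -(fineK fA) lee_fin leNgt => /negP; apply.
by apply: lt_le_trans (truncnS_gt _) _; rewrite ler_nat.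
Qed.

Lemma finite_enum (A : set U) : finite_set A ->
  exists F : seq U, uniq F /\ A = [set` F].
Proof.
move=> /finite_seqP[s ->]; exists (undup s); split; first exact: undup_uniq.
by apply/seteqP; split => x /=; rewrite mem_undup.
Qed.

Lemma esum_seq (F : seq U) (f : U -> R) : uniq F -> (forall x, 0 <= f x) ->
  (\esum_(x in [set` F]) (f x)%:E = (\sum_(x <- F) f x)%:E)%E.
Proof.
move=> uF f0; rewrite esum_fset //; first by rewrite -fsbig_seq // sumEFin.
by move=> i _; rewrite lee_fin.
Qed.

Lemma ecard_seq (F : seq U) : uniq F -> @ecard R U [set` F] = ((size F)%:R)%:E.
Proof.
move=> uF; rewrite /ecard (@esum_seq F (fun=> 1)) //.
by rewrite big_const_seq count_predT iter_addr_0.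
Qed.

End finite_counts.

Section limsup.
Context (R : realType).

Lemma limsup_pinfty_frequently (f : R -> \bar R) (x : R) :
  (forall eta M : R, 0 < eta -> exists2 a, M < a & ((x - eta)%:E <= f a)%E) ->
  (x%:E <= limsup_pinfty f)%E.
Proof.
move=> h; rewrite /limsup_pinfty limf_esupE.
apply: le_ereal_inf_tmp => _ [V [M [_ MV]] <-].
apply/lee_addgt0Pr => eta eta0; have [a Ma fa] := h eta M eta0.
rewrite -leeBlDr // -EFinB; apply: (le_trans fa); apply: ereal_sup_ubound.
by exists a => //; exact: MV.
Qed.

(** A finite upper limit bounds the values near infinity, so a point where f is close to it can be
    chosen with f finite. Finiteness matters because [fine] would turn an infinite count into 0. *)
Lemma limsup_pinfty_approx (f : R -> \bar R) (g k : R) (M : R) :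
  limsup_pinfty f = g%:E -> k < g ->
  exists a, [/\ M < a, (k%:E < f a)%E & (f a < +oo)%E].
Proof.
rewrite /limsup_pinfty limf_esupE => hg kg.
have : (ereal_inf [set ereal_sup (f @` V) | V in pinfty_nbhs R] < (g + 1)%:E)%E.
  by rewrite hg lte_fin ltrDl.
move/ereal_inf_lt => [_ [V [M0 [M0r M0V]] <-] Vlt].
pose V' : set R := [set a | Num.max M M0 < a].
have : (g%:E <= ereal_sup (f @` V'))%E.
  rewrite -hg; apply: ereal_inf_lbound; exists V' => //.
  by exists (Num.max M M0); split => //; exact: num_real.
move=> h; have : (k%:E < ereal_sup (f @` V'))%E by apply: lt_le_trans h; rewrite lte_fin.
move/ereal_sup_gt => [_ [a aV <-] ka]; exists a.
move: aV; rewrite /V' /= gt_max => /andP[Ma M0a]; split => //.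
apply: (@le_lt_trans _ _ (ereal_sup (f @` V))).
  by apply: ereal_sup_ubound; exists a => //; exact: M0V.
by apply: (lt_trans Vlt); exact: ltry.
Qed.

Lemma cvg_ratio (M : nat) (rho eps : R) : 0 < eps ->
  exists a0 : R, 0 < a0 /\ forall a, a0 < a ->
    (a + 2 * rho) ^+ M <= (1 + eps) * a ^+ M.
Proof.
move=> eps0.
have h : (1 + 2 * rho * a^-1) ^+ M @[a --> +oo%R] --> ((1 + 2 * rho * 0) ^+ M : R).
  apply: (cvg_comp (fun a : R => 1 + 2 * rho * a^-1) (fun x => x ^+ M)); last exact: exprn_continuous.
  apply: cvgD; first exact: cvg_cst.
  apply: cvgMr; apply/gtr0_cvgV0; last exact: cvg_id.
  by near=> x; near: x; exact: nbhs_pinfty_gt.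
rewrite mulr0 addr0 expr1n in h.
have [a0 [_ ha0]] : \forall a \near +oo%R, (1 + 2 * rho * a^-1) ^+ M < 1 + eps.
  by apply: (cvgr_lt (1 : R) h); rewrite ltrDl.
exists (Num.max a0 1); split; first by rewrite lt_max ltr01 orbT.
move=> a; rewrite gt_max => /andP[/ha0 /ltW h1 a1].
have a_gt0 : 0 < a by apply: lt_trans a1; exact: ltr01.
have -> : a + 2 * rho = (1 + 2 * rho * a^-1) * a.
  by field; rewrite gt_eqF.
by rewrite exprMn ler_wpM2r // exprn_ge0 // ltW.
Unshelve. all: by end_near. Qed.

(** At arbitrarily large a the number of codewords is nearly gamma times the cube volume, so the
    volume of the enlarged cube exceeds (size F) / gamma by at most a small fraction of size F.
    After division by size F the correction weighted by K is below eta / 2. Only such a are used,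
    which is enough for an upper limit. *)
Lemma density_limsup l (S : set 'cV[R[i]]_l) (e : 'cV[R[i]]_l -> R) (gamma p : R) :
  density S = gamma%:E -> 0 < gamma -> (forall s, 0 <= e s) ->
  (forall eta, 0 < eta -> exists rho K, 0 <= K /\
    forall a (F : seq 'cV[R[i]]_l), 0 < a -> uniq F ->
      (forall s, s \in F -> S s /\ @cube R a l s) ->
      (size F)%:R * (p - eta) - K * ((a + 2 * rho) ^+ (2 * l) - (size F)%:R / gamma)
        <= \sum_(s <- F) e s) ->
  (p%:E <= limsup_pinfty (fun a => (\esum_(s in S `&` @cube R a l) (e s)%:E) *
    ((fine (@ecard R _ (S `&` @cube R a l)))^-1)%:E))%E.
Proof.
move=> dS g0 e0 hcount; apply: limsup_pinfty_frequently => eta M eta0.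
have eta20 : 0 < eta / 2 by rewrite divr_gt0.
have [rho [K [K0 hK]]] := hcount _ eta20.
(* Chosen so that K times 2 eps / gamma is at most eta / 2; K + 1 keeps the division legitimate when
   K = 0. *)
pose eps := eta / 2 * gamma / (K + 1) / 2.
have K1 : 0 < K + 1 by apply: ltr_wpDl.
have eps0 : 0 < eps by rewrite !divr_gt0 // mulr_gt0.
have [a0 [a00 ha0]] := cvg_ratio (2 * l) rho eps0.
(* A threshold below gamma for which a density above [kap] turns (1 + eps) a^(2l) into at most (1 +
   2 eps) (size F) / gamma. *)
pose kap := gamma * (1 + eps) / (1 + 2 * eps).
have kapg : kap < gamma.
  rewrite /kap ltr_pdivrMr; last by apply: addr_gt0 => //; apply: mulr_gt0.
  by rewrite ltr_pM2l // ltrD2l ltr_pMl // ltrDl.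
have [a [Ma ka foo]] := limsup_pinfty_approx (Num.max M a0) dS kapg.
move: Ma; rewrite gt_max => /andP[Ma a0a].
have a_gt0 : 0 < a by exact: lt_trans a0a.
have al0 : 0 < a ^+ (2 * l) by rewrite exprn_gt0.
set A := S `&` @cube R a l in foo ka *.
(* An infinite count would make the normalised count infinite at this a. *)
have finA : finite_set A.
  apply: (@ecard_lty_finite R); rewrite ltey; apply/eqP => Aoo.
  by move: foo; rewrite Aoo gt0_mulye ?ltxx // lte_fin invr_gt0.
have [F [uF AF]] := finite_enum finA.
exists a => //; rewrite -/A AF esum_seq // ecard_seq //= -EFinM lee_fin.
move: ka; rewrite AF ecard_seq // -EFinM lte_fin ltr_pdivlMr // => kF.
have e1 : 0 < 1 + eps by rewrite addr_gt0.
have e2 : 0 < 1 + 2 * eps by rewrite addr_gt0 // mulr_gt0.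
have kap0 : 0 < kap by rewrite divr_gt0 // mulr_gt0.
have sF0 : 0 < (size F)%:R :> R by apply: lt_trans kF; rewrite mulr_gt0.
rewrite ler_pdivlMr //.
have FS s : s \in F -> S s /\ @cube R a l s.
  move=> sF; have : [set` F] s by [].
  by rewrite -AF => -[].
apply: le_trans (hK a F a_gt0 uF FS); rewrite mulrC.
set n := (size F)%:R in sF0 kF *.
have h1 : (a + 2 * rho) ^+ (2 * l) <= n / gamma * (1 + 2 * eps).
  apply: (le_trans (ha0 a a0a)).
  have : kap * a ^+ (2 * l) * ((1 + 2 * eps) / gamma) <= n * ((1 + 2 * eps) / gamma).
    by rewrite ler_wpM2r ?(ltW kF) // divr_ge0 // ltW.
  have -> : kap * a ^+ (2 * l) * ((1 + 2 * eps) / gamma) = (1 + eps) * a ^+ (2 * l).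
    by rewrite /kap; field; rewrite !gt_eqF.
  by rewrite mulrA [in X in _ -> X]mulrAC.
have h2 : K * ((a + 2 * rho) ^+ (2 * l) - n / gamma) <= n * (eta / 2).
  apply: (@le_trans _ _ (K * (n / gamma * (2 * eps)))).
    rewrite ler_wpM2l // lerBlDr; apply: (le_trans h1).
    by rewrite mulrDr mulr1 addrC.
  have -> : K * (n / gamma * (2 * eps)) = n * (eta / 2) * (K / (K + 1)).
    by rewrite /eps; field; rewrite !gt_eqF.
  rewrite -[leRHS]mulr1 ler_wpM2l //; first by rewrite mulr_ge0 ?ltW.
  by rewrite ler_pdivrMr // mul1r lerDl.
have -> : n * (p - eta) = n * (p - eta / 2) - n * (eta / 2) by field.
by rewrite lerD2l lerN2.
Qed.

End limsup.

(** * Error probability for a fixed channel *)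

Section gauss_density_const.
Context (R : realType).

(** The rate 1/(2 s^2) in the exponent of the normal density of standard deviation s. *)
Definition grate (s : R) : R := (s ^+ 2 *+ 2)^-1.

Lemma gauss_density_const N (s : R) (x : 'cV[R]_N) : s != 0 ->
  gauss_density (fun _ => s) x =
  (normal_peak s ^+ N * expR (- (grate s * sqn x)))%:E.
Proof.
move=> s0; rewrite /gauss_density prodEFin; congr EFin.
under eq_bigr do rewrite normal_pdfE //.
rewrite big_split /= prodr_const card_ord; congr (_ * _).
rewrite /sqn mulr_sumr -sumrN expR_sum; apply: eq_bigr => k _.
by rewrite /normal_fun subr0 mulNr mulrC.
Qed.

Lemma integral_gauss_density N (s : R) : s != 0 ->
  (\int[@lebN R N]_x gauss_density (fun _ => s) x = 1)%E.
Proof.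
move=> s0; rewrite /gauss_density.
rewrite (@lebN_prod R N (fun _ y => (normal_pdf 0 s y)%:E)).
- by rewrite big1 // => k _; rewrite integral_normal_pdf.
- by move=> k; apply/measurable_EFinP; exact: measurable_normal_pdf.
- by move=> k x; rewrite lee_fin normal_pdf_ge0.
Qed.

End gauss_density_const.

Section fixed_channel.
Context (R : realType) (m l : nat) (H : 'M[R[i]]_(m, l)).
Local Notation D := (complex.Re (\det (adjoint H *m H))).
Hypothesis lm : (l <= m)%N.
Hypothesis D0 : D != 0.
Local Notation q u := (sqn (rmx H *m u)).

(** The square Gram factor, realified: passing to real coordinates replaces det T by |det T|^2,
    which is the determinant of the Gram matrix of H. *)
Lemma gram_rmx : exists2 T : 'M[R]_(l + l), \det T = D &
  forall u, q u = sqn (T *m u).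
Proof.
have [T TH] := gram_factor H lm; exists (rmx T).
  by rewrite -TH det_gram det_rmx.
move=> u; rewrite -[u]complexvK -!realv_mulmx !sqn_realv.
exact/esym/normsq_gram.
Qed.

Lemma det_gram_ge0 : 0 <= D.
Proof.
have [T TH] := gram_factor H lm; rewrite -TH det_gram /=.
by rewrite addr_ge0 // sqr_ge0.
Qed.

Lemma det_gram_gt0 : 0 < D.
Proof. by rewrite lt_neqAle eq_sym D0 det_gram_ge0. Qed.

Lemma rmx_inj (u : 'cV[R]_(l + l)) : rmx H *m u = 0 -> u = 0.
Proof.
move=> Hu; have [T dT qT] := gram_rmx.
have : T *m u = 0.
  by apply: sqn_eq0; rewrite -qT Hu /sqn big1 // => k _; rewrite mxE expr0n.
have uT : T \in unitmx by rewrite unitmxE unitfE dT.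
by move=> Tu; rewrite -(mulKmx uT u) Tu mulmx0.
Qed.

Lemma channel_inj : injective (fun s : 'cV[R[i]]_l => H *m s).
Proof.
move=> s s' /= e; apply: realv_inj; apply/eqP; rewrite -subr_eq0 -realvB.
apply/eqP; apply: rmx_inj; rewrite -realv_mulmx mulmxBr e subrr.
by apply/colP => k; rewrite mxE; case: (split_ordP k) => j ->;
  rewrite ?col_mxEu ?col_mxEd !mxE.
Qed.

Lemma integral_form (g : R -> \bar R) : measurable_fun setT g -> (forall y, 0 <= g y)%E ->
  (\int[@lebN R (l + l)]_u g (q u) = D^-1%:E * \int[@lebN R (l + l)]_x g (sqn x))%E.
Proof.
move=> mg g0; have [T dT qT] := gram_rmx.
under eq_integral do rewrite qT.
rewrite (@lebN_mulmx R (l + l) T (fun x => g (sqn x))) //.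
- by rewrite dT gtr0_norm // det_gram_gt0.
- by rewrite unitmxE unitfE dT.
- exact: (measurableT_comp mg (@measurable_sqn R _)).
Qed.

Variable s : R.
Hypothesis s0 : s != 0.

(* [height (|Hu|^2)] is the density at u of the noise projected on the image of H. *)
Definition height (y : R) : R := D * normal_peak s ^+ (l + l) * expR (- (grate s * y)).

Lemma height_ge0 y : 0 <= height y.
Proof.
by rewrite !mulr_ge0 ?expR_ge0 ?det_gram_ge0 // exprn_ge0 // normal_peak_ge0.
Qed.

Lemma grate_ge0 : 0 <= grate s.
Proof. by rewrite invr_ge0 mulrn_wge0 // sqr_ge0. Qed.

Lemma height_dec x y : x <= y -> height y <= height x.
Proof.
move=> xy; rewrite ler_wpM2l //.
  by rewrite mulr_ge0 ?det_gram_ge0 // exprn_ge0 // normal_peak_ge0.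
by rewrite ler_expR lerN2 ler_wpM2l // grate_ge0.
Qed.

Lemma measurable_height : measurable_fun setT height.
Proof.
apply: measurable_funM => //; apply: measurableT_comp => //.
by apply: measurableT_comp => //; apply: measurable_funM.
Qed.

Definition noise_law (W : set 'cV[R]_(l + l)) : \bar R :=
  (\int[lebN]_(u in W) (height (q u))%:E)%E.

(** Substituting x = T u cancels the factor D of [height] and leaves the standard density in
    dimension 2l. This is where z', with nt complex coordinates, replaces the noise at the
    receiver. *)
Lemma nu_form (B : set R) : measurable B ->
  noise_law [set u | B (q u)] =
  (\int[@lebN R (l + l)]_(x in [set x | B (sqn x)]) gauss_density (fun _ => s) x)%E.
Proof.
move=> mB; pose g y : \bar R := (height y * \1_B y)%:E.
have mg : measurable_fun setT g.
  by apply/measurable_EFinP; apply: measurable_funM => //; exact: measurable_height.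
have g0 y : (0 <= g y)%E by rewrite lee_fin mulr_ge0 // height_ge0.
transitivity (\int[@lebN R (l + l)]_u g (q u))%E.
  rewrite /noise_law integral_mkcond; apply: eq_integral => u _; rewrite patchE /g indicE.
  rewrite (_ : (u \in _) = (q u \in B)); last by apply/idP/idP; rewrite !inE.
  by case: ifP; rewrite ?mulr1 ?mulr0.
rewrite integral_form // -ge0_integralZl; last 4 first.
- exact: measurableT.
- exact: (measurableT_comp mg (@measurable_sqn R _)).
- by move=> x _.
- by rewrite lee_fin invr_ge0 det_gram_ge0.
rewrite [RHS]integral_mkcond; apply: eq_integral => x _.
rewrite patchE /g indicE (_ : (x \in _) = (sqn x \in B)); last by apply/idP/idP; rewrite !inE.
rewrite -EFinM gauss_density_const // /height.
case: ifP; rewrite ?mulr1 ?mulr0 // => _; congr EFin.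
by rewrite !mulrA mulVf // mul1r.
Qed.

Lemma nuT : noise_law setT = 1%E.
Proof.
exact: etrans (nu_form measurableT) (integral_gauss_density _ s0).
Qed.

End fixed_channel.

Section projected_noise.
Context (R : realType) (m l : nat) (H : 'M[R[i]]_(m, l)).
Local Notation D := (complex.Re (\det (adjoint H *m H))).
Hypothesis lm : (l <= m)%N.
Hypothesis D0 : D != 0.
Variable s : R.
Hypothesis s0 : s != 0.
Local Notation q u := (sqn (rmx H *m u)).
Local Notation nu := (noise_law H s).
Context d (T : measurableType d) (P : probability T R) (X : 'I_(m + m) -> T -> R).
Hypothesis mX : forall k, measurable_fun setT (X k).
Hypothesis lawX : forall B, measurable B ->
  P (vec_of X @^-1` B) = (\int[lebN]_(x in B) gauss_density (fun _ => s) x)%E.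

Lemma gauss_kernel_measurable N (c : R) (f : 'cV[R]_N -> R) :
  measurable_fun setT f -> measurable_fun setT (fun x => (expR (- (c * f x)))%:E).
Proof.
move=> mf; apply/measurable_EFinP; apply: measurableT_comp => //.
by apply: measurableT_comp => //; apply: measurable_funM.
Qed.

(** The condition says that E is a cylinder along the orthogonal complement of the image of H. Both
    sides are then constant multiples of the same integral over U, with constants independent of E
    and U. *)
Lemma projected_law (E : set 'cV[R]_(m + m)) (U : set 'cV[R]_(l + l)) :
  measurable E -> measurable U ->
  (forall u v, (rmx H)^T *m v = 0 -> (E (rmx H *m u + v) <-> U u)) ->
  P (vec_of X @^-1` E) = nu U.
Proof.
have [C CE] := gauss_projection (grate s) (rmx_inj lm D0).
pose e (u : 'cV[R]_(l + l)) : \bar R := (expR (- (grate s * q u)))%:E.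
have me : measurable_fun setT e by apply: gauss_kernel_measurable; exact: measurable_q.
have e0 u : (0 <= e u)%E by rewrite lee_fin expR_ge0.
pose b : R := D * normal_peak s ^+ (l + l).
have b0 : 0 < b by rewrite mulr_gt0 ?det_gram_gt0 // exprn_gt0 // normal_peak_gt0.
have nuE U' : measurable U' -> nu U' = (b%:E * \int[lebN]_(u in U') e u)%E.
  move=> mU'; rewrite -ge0_integralZl //.
  - exact: measurable_funTS.
  - by rewrite lee_fin ltW.
have PE E' U' : measurable E' -> measurable U' ->
    (forall u v, (rmx H)^T *m v = 0 -> (E' (rmx H *m u + v) <-> U' u)) ->
    P (vec_of X @^-1` E') =
      ((normal_peak s ^+ (m + m))%:E * C * \int[lebN]_(u in U') e u)%E.
  move=> mE' mU' EU'; rewrite lawX // -muleA -(CE E' U') // -ge0_integralZl //.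
  - by apply: eq_integral => x _; rewrite gauss_density_const // EFinM.
  - by apply: measurable_funTS; apply: gauss_kernel_measurable; exact: measurable_sqn.
  - by rewrite lee_fin exprn_ge0 // normal_peak_ge0.
move=> mE mU EU; rewrite (PE E U) // nuE //; congr (_ * _)%E.
have IT : (\int[lebN]_(u in setT) e u = (b^-1)%:E)%E.
  have := nuE setT measurableT; rewrite nuT // => h.
  have : ((b^-1)%:E * 1 = (b^-1)%:E * (b%:E * \int[lebN]_(u in setT) e u))%E by rewrite -h.
  by rewrite mule1 muleA -EFinM mulVf ?gt_eqF // mul1e.
(* For the full space both laws have mass 1, so the two constants agree. *)
have := PE setT setT measurableT measurableT (fun _ _ _ => iff_refl _).
rewrite preimage_setT probability_setT IT => h1.
have : (1 * b%:E = (normal_peak s ^+ (m + m))%:E * C * (b^-1)%:E * b%:E)%E by rewrite -h1.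
by rewrite mul1e -muleA -EFinM mulVf ?gt_eqF // mule1.
Qed.

Variables (z : T -> 'cV[R[i]]_m) (S : set 'cV[R[i]]_l).
Hypothesis zX : forall w, realv (z w) = vec_of X w.
Hypothesis cS : countable S.

Lemma countable_realv : countable (@realv R l @` S).
Proof. exact: sub_countable (card_image_le _ _) cS. Qed.

Definition noise_cell (st : 'cV[R]_(l + l)) : set 'cV[R]_(m + m) :=
  [set x | forall s', (@realv R l @` S) s' -> sqn x <= sqn (x - rmx H *m (s' - st))].

Lemma measurable_noise_cell st : measurable (noise_cell st).
Proof.
rewrite (_ : noise_cell st = \bigcap_(s' in @realv R l @` S)
   [set x | sqn x <= sqn (x - rmx H *m (s' - st))]); last first.
  by apply/seteqP; split => u h s' Ss'; exact: h.
apply: countable_bigcap_measurable => [|s' _]; first exact: countable_realv.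
rewrite -[X in measurable X]setTI; apply: measurable_fun_le => //.
  exact: measurable_sqn.
exact: (measurableT_comp (@measurable_sqn R _) (measurable_addv _)).
Qed.

(** Each Voronoi comparison sets |x|^2 against |x - H v|^2. A noise component orthogonal to the
    image of H adds the same square to both, so the region of correct decision is a cylinder over
    [cell]. *)
Lemma error_probability_cell st : S st ->
  P [set w' | ~ voronoi ((fun x => H *m x) @` S) (H *m st) (H *m st + z w')] =
  (1 - nu (cell (rmx H) (@realv R l @` S) (realv st)))%E.
Proof.
move=> Sst.
rewrite -(projected_law (measurable_noise_cell (realv st))
  (measurable_cell (rmx H) (realv st) countable_realv)); last first.
  move=> u v Av; split => h s' Ss'; have := h s' Ss';
    rewrite -addrAC -mulmxBr !sqnD_orth ?lerD2r //;
    by rewrite trmx_mul -mulmxA Av mulmx0.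
rewrite -probability_setC; last first.
  rewrite -[X in measurable X]setTI; apply: measurable_vec_of => //.
  exact: measurable_noise_cell.
have e1 w : H *m st + z w - H *m st = z w by rewrite addrAC subrr add0r.
have e2 w s' : H *m st + z w - H *m s' = z w - H *m (s' - st).
  by rewrite mulmxBr opprB addrCA addrA.
congr (P _); apply/seteqP; split => w /= h h'; apply: h.
  move=> _ [s' Ss' <-]; have := h' (realv s') (ex_intro2 _ _ s' Ss' erefl).
  by rewrite -zX -realvB -realv_mulmx -realvB !sqn_realv e1 e2.
move=> _ [s' Ss' <-]; have := h' (H *m s') (ex_intro2 _ _ s' Ss' erefl).
by rewrite -zX -realvB -realv_mulmx -realvB !sqn_realv e1 e2.
Qed.

End projected_noise.

(** In use, B is the noise mass of a cell, A that of its truncation, c the volume of the truncation,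
    E and g the mass and volume of the ellipsoid, eps the mass outside the truncating cube and p the
    target probability. *)
Lemma truncation_step (R : realFieldType) (A B c E eps h g p : R) :
  A + h * g <= E + h * c -> B <= A + eps -> p = 1 - E ->
  p - eps - h * c + h * g <= 1 - B.
Proof. by lra. Qed.

(** * Averaging over the codewords of a cube *)

Section counting.
Context (R : realType) (m l : nat) (H : 'M[R[i]]_(m, l)).
Local Notation D := (complex.Re (\det (adjoint H *m H))).
Hypothesis lm : (l <= m)%N.
Hypothesis D0 : D != 0.
Variable s : R.
Hypothesis s0 : s != 0.
Local Notation q u := (sqn (rmx H *m u)).
Local Notation nu := (noise_law H s).
Local Notation L := (l + l)%N.

Let mh : measurable_fun setT (fun u : 'cV[R]_L => (height H s (q u))%:E).
Proof.
apply/measurable_EFinP; apply: (measurableT_comp (measurable_height H s)).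
exact: measurable_q.
Qed.

Let h0 (u : 'cV[R]_L) : (0 <= (height H s (q u))%:E)%E.
Proof. by rewrite lee_fin height_ge0. Qed.

Let num : {measure set 'cV[R]_L -> \bar R} := density_measure lebN mh h0.

Lemma nu_le1 W : measurable W -> (nu W <= 1)%E.
Proof.
move=> mW; rewrite -(nuT lm D0 s0).
by apply: (@le_measure _ _ _ num); rewrite ?inE.
Qed.

Lemma nu_fin W : measurable W -> nu W = (fine (nu W))%:E.
Proof.
move=> mW; rewrite fineK // ge0_fin_numE; last exact: (measure_ge0 num).
by apply: (le_lt_trans (nu_le1 mW)); exact: ltry.
Qed.

Lemma nu_split W Q : measurable W -> measurable Q ->
  fine (nu W) <= fine (nu (W `&` Q)) + fine (nu (~` Q)).
Proof.
move=> mW mQ; have mQ' := measurableC mQ.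
rewrite -lee_fin EFinD -!nu_fin //; last exact: measurableI.
rewrite -[X in nu X](setIT W) -(setUv Q) setIUr.
have -> : (nu (W `&` Q `|` W `&` ~` Q) = nu (W `&` Q) + nu (W `&` ~` Q))%E.
  apply: (measureU num); [exact: measurableI|exact: measurableI|].
  by rewrite setIACA setICr setI0.
rewrite leeD2l //; apply: (@le_measure _ _ _ num); rewrite ?inE //.
exact: measurableI.
Qed.

(** Tightness of the projected noise: continuity from below along the exhausting cubes, whose union
    has mass 1. *)
Lemma nu_tail eta : 0 < eta -> exists2 rho, 0 < rho &
  fine (nu (~` @opencube R L rho)) <= eta.
Proof.
move=> eta0; pose F n := @opencube R L (n.+1)%:R.
have mF n : measurable (F n) by exact: measurable_opencube.
have UF : \bigcup_n F n = setT.
  apply/seteqP; split => // x _; exists (Num.truncn (\sum_k `|x k 0|)) => // k /=.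
  by apply: le_lt_trans (truncnS_gt _); rewrite (bigD1 k) //= lerDl sumr_ge0.
have ndF : nondecreasing_seq F.
  move=> i j ij; apply/subsetPset => x h k; apply: (lt_le_trans (h k)).
  by rewrite ler_nat ltnS.
have cF : num (F n) @[n --> \oo] --> num (\bigcup_n F n).
  by apply: nondecreasing_cvg_mu => //; rewrite UF.
rewrite UF in cF.
have nT : num setT = 1%E by exact: (nuT lm D0 s0).
rewrite nT in cF.
have [N _ hN] : \forall n \near \oo, 1 - eta < fine (num (F n)).
  by apply: (cvgr_gt (1 : R) (fine_cvg cF)); rewrite ltrBlDr ltrDl.
exists (N.+1)%:R => //.
have := hN N (leqnn N); rewrite /= => h.
have mC : measurable (~` F N) by exact: measurableC.
have e1 : (nu (F N) + nu (~` F N) = 1)%E.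
  rewrite -[RHS]nT -[X in _ = num X](setUv (F N)); apply/esym/(measureU num) => //.
  by rewrite setICr.
move: h; rewrite -[num _]/(nu _).
move: e1; rewrite (nu_fin (mF N)) (nu_fin mC) -EFinD => -[]; lra.
Qed.

Lemma measurable_lt_ray (r : R) : measurable [set y : R | y < r].
Proof.
rewrite (_ : [set y | _] = `]-oo, r[%classic); first exact: measurable_itv.
by apply/seteqP; split => x /=; rewrite in_itv.
Qed.

Lemma measurable_ellipsoid r : measurable [set u : 'cV[R]_L | q u < r].
Proof.
have := measurable_q (rmx H) measurableT (measurable_lt_ray r); by rewrite setTI.
Qed.

Variables (gamma r2 : R).
Hypothesis gamma0 : 0 < gamma.
Hypothesis r20 : 0 < r2.
Hypothesis r2E : Vball R l * r2 ^+ l = D / gamma.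

Lemma ellipsoid_volume : lebN [set u : 'cV[R]_L | q u < r2] = (gamma^-1)%:E.
Proof.
pose g y : \bar R := (\1_[set y : R | y < r2] y)%:E.
have mI := measurable_lt_ray r2.
have mg : measurable_fun setT g by apply/measurable_EFinP; exact: measurable_indic.
have mE := measurable_ellipsoid r2.
have := integral_form lm D0 mg (fun y => _); rewrite /g => h.
transitivity (\int[@lebN R L]_u g (q u))%E.
  rewrite -[X in lebN X]setIT -integral_indic //.
rewrite h; last by move=> y; rewrite lee_fin.
transitivity (D^-1%:E * lebN [set x : 'cV[R]_L | (sqn x < r2)%R])%E.
  congr (_ * _)%E; rewrite -[X in lebN X]setIT -integral_indic //.
  exact: measurable_ball.
rewrite ball_volume // -EFinM r2E; congr EFin; field.
by rewrite D0 gt_eqF.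
Qed.

(** Each codeword is compared with an ellipsoid of volume 1/gamma. Because the comparison is affine
    in the cell volumes, only their sum enters, and the packing bound replaces it by the volume of
    one cube. *)
Lemma cell_counting (S : set 'cV[R]_L) (F : seq 'cV[R]_L) (a rho : R) :
  countable S -> uniq F -> (forall x, x \in F -> S x /\ opencube a x) ->
  0 < a -> 0 < rho ->
  (size F)%:R * (fine (nu [set u | r2 <= q u]) - fine (nu (~` @opencube R L rho)))
    - height H s r2 * ((2 * (a + rho)) ^+ L - (size F)%:R / gamma)
  <= \sum_(x <- F) (1 - fine (nu (cell (rmx H) S x))).
Proof.
move=> cS uF FS a0 rho0.
set p := fine (nu [set u | _]); set eps := fine (nu (~` _)); set h := height H s r2.
have hge0 : 0 <= h by exact: height_ge0.
pose Q := @opencube R L rho.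
have mQ : measurable Q by exact: measurable_opencube.
have mc x : measurable (cell (rmx H) S x) by exact: measurable_cell.
pose W x := cell (rmx H) S x `&` Q.
have mW x : measurable (W x) by exact: measurableI.
have Wfin x : lebN (W x) = (fine (lebN (W x)))%:E.
  rewrite fineK // ge0_fin_numE; last exact: measure_ge0.
  apply: (@le_lt_trans _ _ (lebN Q)); last by rewrite lebN_opencube // ltry.
  by apply: le_measure; rewrite ?inE //; exact: subIsetr.
have mE := measurable_ellipsoid r2.
have CE : [set u : 'cV[R]_L | r2 <= q u] = ~` [set u | q u < r2].
  by apply/seteqP; split => u /=; rewrite leNgt => /negP.
have pE : p = 1 - fine (nu [set u | q u < r2]).
  have mC : measurable (~` [set u : 'cV[R]_L | q u < r2]) by exact: measurableC.
  have : (nu [set u | (q u < r2)%R] + nu (~` [set u | (q u < r2)%R]) = 1)%E.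
    rewrite -(nuT lm D0 s0) -[X in _ = nu X](setUv [set u : 'cV[R]_L | q u < r2]).
    by apply/esym/(measureU num) => //; rewrite setICr.
  rewrite (nu_fin mE) (nu_fin mC) -EFinD -CE => -[]; rewrite -/p => <-.
  by rewrite addrAC subrr add0r.
have hpos y : 0 <= height H s y by exact: height_ge0.
have hdec x y : x <= y -> height H s y <= height H s x by exact: height_dec.
have step x : p - eps - h * fine (lebN (W x)) + h / gamma <=
    1 - fine (nu (cell (rmx H) S x)).
  have : (nu (W x) + h%:E * lebN [set u : 'cV[R]_L | (q u < r2)%R] <=
      nu [set u | (q u < r2)%R] + h%:E * lebN (W x))%E.
    exact: (@tangent_ineq _ _ R lebN (fun u : 'cV[R]_L => q u) (height H s) r2
      (measurable_q _) (measurableT_comp (measurable_height H s) (measurable_q _))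
      hpos hdec (W x) (mW x)).
  rewrite ellipsoid_volume Wfin (nu_fin (mW x)) (nu_fin mE) -!EFinM -!EFinD lee_fin.
  move=> h1; exact: (truncation_step h1 (nu_split (mc x) mQ) pE).
have packing := cell_packing (rmx_inj lm D0) rho0 cS uF FS.
have sumW : \sum_(x <- F) fine (lebN (W x)) <= (2 * (a + rho)) ^+ L.
  rewrite -lee_fin -sumEFin -lebN_opencube ?addr_gt0 //.
  by under eq_bigr do rewrite -Wfin.
apply: (@le_trans _ _ (\sum_(x <- F) (p - eps - h * fine (lebN (W x)) + h / gamma))).
  rewrite !big_split /= !sumrN -!mulr_sumr !big_const_seq !count_predT !iter_addr_0.
  rewrite -(mulr_natl p) -(mulr_natl eps) -(mulr_natl gamma^-1).
  have := ler_wpM2l hge0 sumW.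
  set sW := \sum_(x <- F) _; set V := (_ ^+ L); set n := (size F)%:R => hV.
  have -> : n * (p - eps) - h * (V - n / gamma) =
    n * p - n * eps - h * V + h * (n * gamma^-1) by ring.
  by rewrite lerD2r lerD2l lerN2.
by apply: ler_sum => x _.
Qed.

End counting.

Section fixed_channel_bound.
Context (R : realType) (m l : nat) (H : 'M[R[i]]_(m, l)).
Local Notation D := (complex.Re (\det (adjoint H *m H))).
Hypothesis lm : (l <= m)%N.
Hypothesis D0 : D != 0.
Variable s : R.
Hypothesis s0 : s != 0.
Local Notation q u := (sqn (rmx H *m u)).
Local Notation nu := (noise_law H s).
Local Notation L := (l + l)%N.
Context d (T : measurableType d) (P : probability T R) (X : 'I_(m + m) -> T -> R).
Hypothesis mX : forall k, measurable_fun setT (X k).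
Hypothesis lawX : forall B, measurable B ->
  P (vec_of X @^-1` B) = (\int[lebN]_(x in B) gauss_density (fun _ => s) x)%E.
Variables (z : T -> 'cV[R[i]]_m) (S : set 'cV[R[i]]_l).
Hypothesis zX : forall w, realv (z w) = vec_of X w.
Hypothesis cS : countable S.
Variables (gamma r2 : R).
Hypothesis gamma0 : 0 < gamma.
Hypothesis r20 : 0 < r2.
Hypothesis r2E : Vball R l * r2 ^+ l = D / gamma.
Hypothesis dS : density S = gamma%:E.

Lemma fixed_channel_bound :
  (nu [set u | (r2 <= q u)%R] <= limsup_pinfty (fun a =>
    let SH := (fun x => H *m x) @` S in
    let box := SH `&` ((fun x => H *m x) @` @cube R a l) in
    (\esum_(y in box) P [set w' | ~ voronoi SH y ((y + z w')%R)]) *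
    ((fine (ecard R box))^-1)%:E))%E.
Proof.
pose S' := @realv R l @` S.
have cS' : countable S' by exact: sub_countable (card_image_le _ _) cS.
pose e st := 1 - fine (nu (cell (rmx H) S' (realv st))).
have mcell st : measurable (cell (rmx H) S' st) by exact: measurable_cell.
have mC : measurable [set u : 'cV[R]_L | r2 <= q u].
  rewrite (_ : [set u | _] = ~` [set u | q u < r2]).
    by apply: measurableC; exact: measurable_ellipsoid.
  by apply/seteqP; split => u /=; rewrite leNgt => /negP.
have e0 st : 0 <= e st.
  rewrite /e subr_ge0 -lee_fin -(nu_fin lm D0 s0) //; exact: (nu_le1 lm D0 s0).
have lim := @density_limsup R l S e gamma (fine (nu [set u | r2 <= q u])) dS gamma0 e0.
rewrite (nu_fin lm D0 s0 mC); apply: le_trans (lim _) _.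
  move=> eta eta0; have [rho rho0 hrho] := nu_tail lm D0 s0 eta0.
  exists rho, (height H s r2); split; first exact: height_ge0.
  move=> a F a0 uF FS.
  have a20 : 0 < a / 2 by rewrite divr_gt0.
  have uF' : uniq [seq realv x | x <- F] by rewrite map_inj_uniq //; exact: realv_inj.
  have FS' x : x \in [seq realv x | x <- F] -> S' x /\ opencube (a / 2) x.
    move=> /mapP[y yF ->]; have [Sy cy] := FS y yF; split; first by exists y.
    move=> k; rewrite /realv; case: (split_ordP k) => j ->.
      by rewrite col_mxEu mxE; have [] := cy j.
    by rewrite col_mxEd mxE; have [] := cy j.
  have := cell_counting lm D0 s0 gamma0 r20 r2E cS' uF' FS' a20 rho0.
  rewrite size_map big_map => h; apply: (le_trans _ h).
  have -> : (2 * (a / 2 + rho)) ^+ (l + l) = (a + 2 * rho) ^+ (2 * l).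
    by rewrite mul2n addnn; congr (_ ^+ _); field.
  rewrite lerD2r ler_wpM2l // lerD2l lerN2 //.
suff -> : (fun a => (\esum_(st in S `&` @cube R a l) (e st)%:E) *
    ((fine (ecard R (S `&` @cube R a l)))^-1)%:E)%E =
  (fun a =>
    let SH := (fun x => H *m x) @` S in
    let box := SH `&` ((fun x => H *m x) @` @cube R a l) in
    (\esum_(y in box) P [set w' | ~ voronoi SH y ((y + z w')%R)]) *
    ((fine (ecard R box))^-1)%:E)%E by [].
apply/funext => a /=.
(* Injectivity of H reindexes the received points by the transmitted ones, so sum and count can be
   taken over the codewords in the cube. *)
have Hinj := channel_inj lm D0.
have -> : ((fun x => H *m x) @` S) `&` ((fun x => H *m x) @` @cube R a l) =
    (fun x => H *m x) @` (S `&` @cube R a l).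
  apply/seteqP; split => [_ [[x Sx <-] [y cy /Hinj yx]]|_ [x [Sx cx] <-]].
    by exists x => //; split => //; rewrite -yx.
  by split; exists x.
have inj : {in S `&` @cube R a l &, injective (fun x => H *m x)}.
  by move=> x y _ _; exact: Hinj.
congr (_ * _)%E.
  rewrite esum_image //; apply: eq_esum => st [Sst _].
  rewrite (error_probability_cell lm D0 s0 mX lawX zX cS Sst).
  by rewrite (nu_fin lm D0 s0 (mcell _)) -EFinB.
by rewrite /ecard esum_image.
Qed.

End fixed_channel_bound.

(** * The random channel *)

Section complex_measurable.
Context (R : realType) d (T : measurableType d).
Local Notation C := (R[i]).

(** Measurability of the two real parts; closure under sums, products and conjugation carries it to
    Gram determinants. *)
Definition cmeasurable (f : T -> C) : Prop :=
  measurable_fun setT (fun w => complex.Re (f w)) /\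
  measurable_fun setT (fun w => complex.Im (f w)).

Lemma cmeasurable_cst (c : C) : cmeasurable (fun _ => c).
Proof. by split; exact: measurable_cst. Qed.

Lemma cmeasurableD f g : cmeasurable f -> cmeasurable g -> cmeasurable (fun w => f w + g w).
Proof.
move=> [f1 f2] [g1 g2]; split.
  rewrite (_ : (fun w => _) = (fun w => complex.Re (f w) + complex.Re (g w))).
    exact: measurable_funD.
  by apply/funext => w; case: (f w) => ? ?; case: (g w).
rewrite (_ : (fun w => _) = (fun w => complex.Im (f w) + complex.Im (g w))).
  exact: measurable_funD.
by apply/funext => w; case: (f w) => ? ?; case: (g w).
Qed.

Lemma cmeasurableM f g : cmeasurable f -> cmeasurable g -> cmeasurable (fun w => f w * g w).
Proof.
move=> [f1 f2] [g1 g2]; split.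
  under eq_fun do rewrite ReM.
  by apply: measurable_funB; apply: measurable_funM.
under eq_fun do rewrite ImM.
by apply: measurable_funD; apply: measurable_funM.
Qed.

Lemma cmeasurable_conj f : cmeasurable f -> cmeasurable (fun w => conjc (f w)).
Proof.
move=> [f1 f2]; split.
  by rewrite (_ : (fun w => _) = (fun w => complex.Re (f w))) //;
    apply/funext => w; case: (f w).
rewrite (_ : (fun w => _) = (fun w => - complex.Im (f w))); first exact: measurableT_comp.
by apply/funext => w; case: (f w).
Qed.

Lemma cmeasurable_sum (I : Type) (r : seq I) (f : I -> T -> C) :
  (forall i, cmeasurable (f i)) -> cmeasurable (fun w => \sum_(i <- r) f i w).
Proof.
move=> mf; elim: r => [|i r IH].
  under eq_fun do rewrite big_nil.
  exact: cmeasurable_cst.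
under eq_fun do rewrite big_cons.
exact: cmeasurableD.
Qed.

Lemma cmeasurable_prod (I : Type) (r : seq I) (f : I -> T -> C) :
  (forall i, cmeasurable (f i)) -> cmeasurable (fun w => \prod_(i <- r) f i w).
Proof.
move=> mf; elim: r => [|i r IH].
  under eq_fun do rewrite big_nil.
  exact: cmeasurable_cst.
under eq_fun do rewrite big_cons.
exact: cmeasurableM.
Qed.

Lemma cmeasurable_det n (A : T -> 'M[C]_n) :
  (forall i j, cmeasurable (fun w => A w i j)) -> cmeasurable (fun w => \det (A w)).
Proof.
move=> mA; apply: cmeasurable_sum => g; apply: cmeasurableM.
  exact: cmeasurable_cst.
by apply: cmeasurable_prod => i.
Qed.

Lemma cmeasurable_gram m n (A : T -> 'M[C]_(m, n)) :
  (forall i j, cmeasurable (fun w => A w i j)) ->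
  cmeasurable (fun w => \det (adjoint (A w) *m A w)).
Proof.
move=> mA; apply: cmeasurable_det => i j; under eq_fun do rewrite mxE.
apply: cmeasurable_sum => k; apply: cmeasurableM => //.
under eq_fun do rewrite !mxE.
exact: cmeasurable_conj.
Qed.

End complex_measurable.

Lemma mutually_independent_box d (T : measurableType d) (R : realType)
    (P : probability T R) (I : finType) (X : I -> T -> R) N (g : 'I_N -> I) :
  injective g -> mutually_independent P X -> box_independent P (fun k => X (g k)).
Proof.
move=> ginj iX A mA.
(* The sets are transported along g; injectivity of g makes the preimage index unique. *)
pose A' i : set R := if [pick k | g k == i] is Some k then A k else setT.
have A'g k : A' (g k) = A k.
  rewrite /A'; case: pickP => [j /eqP/ginj -> //|/(_ k)]; by rewrite eqxx.
have mA' i : measurable (A' i) by rewrite /A'; case: pickP.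
have -> : (\prod_(k < N) P (X (g k) @^-1` A k) =
    \prod_(i in [set g k | k : 'I_N]) P (X i @^-1` A' i))%E.
  rewrite big_imset /=; last by move=> x y _ _; exact: ginj.
  by apply: eq_big => k; rewrite ?inE // A'g.
rewrite -iX //; congr (P _); apply/seteqP; split => w /=.
  move=> h i /imsetP[k _ ->]; rewrite /= A'g.
  by have := h k; rewrite mxE.
move=> h k; rewrite mxE; have := h (g k) (imset_f g (isT : k \in predT)).
by rewrite /= A'g.
Qed.

(* The integrand of err_prob is not known to be measurable; the integral of a
   nonnegative function is a supremum over simple functions below it, and is
   monotone regardless. *)
Lemma ge0_le_integral_nonmeasurable d (T : measurableType d) (R : realType)
    (m : {measure set T -> \bar R}) (f g : T -> \bar R) :
  (forall x, 0 <= f x)%E -> (forall x, f x <= g x)%E ->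
  (\int[m]_x f x <= \int[m]_x g x)%E.
Proof.
move=> f0 fg; have g0 x : (0 <= g x)%E by exact: le_trans (fg x).
rewrite !ge0_integralTE //; apply: ge_ereal_sup => _ [h hf <-].
apply: ereal_sup_ubound; exists h => // x.
exact: le_trans (hf x) (fg x).
Qed.

Lemma measurable_le_prod d1 d2 (T1 : measurableType d1) (T2 : measurableType d2)
    (R : realType) (f : T1 -> R) (g : T2 -> R) :
  measurable_fun setT f -> measurable_fun setT g ->
  measurable [set p : T1 * T2 | f p.1 <= g p.2].
Proof.
move=> mf mg; rewrite -[X in measurable X]setTI; apply: measurable_fun_le => //.
  exact: (measurableT_comp mf).
exact: (measurableT_comp mg).
Qed.

Section random_channel.
Context (R : realType) (n r t : nat).
Local Notation C := (R[i]).
Local Notation I := ('I_n * 'I_r * 'I_t * bool)%type.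
Local Notation K := #|{: I}|.

Definition coord_re (i : 'I_n) (a : 'I_r) (b : 'I_t) (x : 'cV[R]_K) : R :=
  x (enum_rank (i, a, b, true)) 0.
Definition coord_im (i : 'I_n) (a : 'I_r) (b : 'I_t) (x : 'cV[R]_K) : R :=
  x (enum_rank (i, a, b, false)) 0.

(** The channel as a function of one real parameter vector, so that rank deficiency becomes a
    Lebesgue-null set of parameters and Gaussianity transfers this to probability zero. *)
Definition channel_of (x : 'cV[R]_K) : 'M[C]_(n * r, n * t) :=
  chan_mat coord_re coord_im x.

Lemma cmeasurable_channel J1 J2 : cmeasurable (fun x => channel_of x J1 J2).
Proof.
rewrite /channel_of /chan_mat /blockdiag.
under eq_fun do rewrite mxE.
case: (blk J1 == blk J2); last exact: cmeasurable_cst.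
under eq_fun do rewrite mxE.
by split; exact: measurable_coord.
Qed.

Lemma measurable_gram_det : measurable_fun setT
  (fun x : 'cV[R]_K => complex.Re (\det (adjoint (channel_of x) *m channel_of x))).
Proof. by have [] := cmeasurable_gram cmeasurable_channel. Qed.

Hypothesis tr : (t <= r)%N.

Lemma diag_index_lt (J : 'I_(n * t)) : (blk J * r + off J < n * r)%N.
Proof.
have o : (off J < r)%N by exact: leq_trans (ltn_ord (off J)) tr.
apply: (@leq_trans ((blk J).+1 * r)); first by rewrite mulSn addnC ltn_add2r.
by rewrite leq_mul2r (ltn_ord (blk J)) orbT.
Qed.

(** Sends a column to the row with the same block and offset. Restricting to these rows keeps the
    upper t rows of each block and leaves a square matrix. *)
Definition diag_index (J : 'I_(n * t)) : 'I_(n * r) := Ordinal (diag_index_lt J).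

Lemma blk_diag_index J : blk (diag_index J) = blk J.
Proof.
apply: val_inj; rewrite /=.
have o : (off J < r)%N by exact: leq_trans (ltn_ord (off J)) tr.
rewrite divnMDl; last exact: leq_ltn_trans o.
by rewrite [(J %% t %/ r)%N]divn_small // addn0.
Qed.

Lemma off_diag_index J : off (diag_index J) = off J :> nat.
Proof.
rewrite /=; have o : (off J < r)%N by exact: leq_trans (ltn_ord (off J)) tr.
by rewrite modnMDl modn_small.
Qed.

(* Coordinates of the channel whose blocks are all the t columns of the partial
   identity of size r x t. *)
Definition diag_dir : 'cV[R]_K :=
  \col_k (let: (i, a, b, c) := (enum_val (k : 'I_K) : I) in (c && (a == b :> nat))%:R).

Lemma channel_line x (c : R) :
  rowsub diag_index (channel_of (x + c *: diag_dir)) =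
  rowsub diag_index (channel_of x) + (c%:C%C)%:M.
Proof.
apply/matrixP => J J'; rewrite !mxE blk_diag_index.
have -> : (J == J') = (blk J == blk J') && (off J == off J' :> nat).
  apply/eqP/andP => [->|[/eqP bJ /eqP oJ]]; first by rewrite !eqxx.
  apply: val_inj; rewrite /= (divn_eq J t) (divn_eq J' t).
  by have := congr1 val bJ; rewrite /= => ->; move: oJ => /= ->.
case: eqP => [bJ|] /=; last by rewrite mulr0n addr0.
rewrite /coord_re /coord_im !mxE !enum_rankK.
have := off_diag_index J; move: (off (diag_index J)) => o /= ->.
case: eqP => _ /=; rewrite ?mulr1n ?mulr0n ?mulr1 ?mulr0 ?addr0 //.
by apply/eqP; rewrite eq_complex /= ?addr0 !eqxx.
Qed.

(** The square Gram factor T is then singular, and a kernel vector of T is one of H because |H u| =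
    |T u|. *)
Lemma gram_singular (H : 'M[C]_(n * r, n * t)) :
  complex.Re (\det (adjoint H *m H)) = 0 ->
  exists2 u : 'cV[C]_(n * t), u != 0 & H *m u = 0.
Proof.
move=> H0; have [T TH] : exists T : 'M[C]_(n * t), adjoint T *m T = adjoint H *m H.
  by apply: gram_factor; rewrite leq_mul2l tr orbT.
have dT : \det T^T = 0.
  move: H0; rewrite -TH det_gram /= => /eqP.
  rewrite paddr_eq0 ?sqr_ge0 // !sqrf_eq0 => /andP[/eqP h1 /eqP h2].
  by rewrite det_tr; apply/eqP; rewrite eq_complex h1 h2 /= !eqxx.
have /eqP/det0P[v v0 vT] := dT; exists v^T.
  by apply: contra v0 => /eqP h; rewrite -[v]trmxK h trmx0.
have Tv : T *m v^T = 0 by rewrite -[T]trmxK -trmx_mul vT trmx0.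
apply: realv_inj; have := normsq_gram v^T (esym TH).
rewrite Tv -!sqn_realv => h.
suff e0 m : realv (0 : 'cV[C]_m) = 0 by rewrite e0; apply: sqn_eq0; rewrite h e0 /sqn big1 // => k _; rewrite mxE expr0n.
by apply/colP => k; rewrite mxE; case: (split_ordP k) => j ->;
  rewrite ?col_mxEu ?col_mxEd !mxE.
Qed.

(* Moving the channel along the block-diagonal partial identity adds c times the
   identity to a square submatrix B, which is singular only if -c is an
   eigenvalue of B: finitely many c on every line. *)
Lemma singular_null :
  lebN [set x | complex.Re (\det (adjoint (channel_of x) *m channel_of x)) = 0] = 0%E.
Proof.
set Z := mkset _.
have mZ : measurable Z.
  rewrite (_ : Z = setT `&` (fun x : 'cV[R]_K =>
      complex.Re (\det (adjoint (channel_of x) *m channel_of x))) @^-1` [set 0]).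
    exact: measurable_gram_det.
  by rewrite setTI.
apply: (lebN_null_lines (v := diag_dir)) => // x.
apply: countable_lebesgue_measure0; apply: finite_set_countable.
pose B := rowsub diag_index (channel_of x).
(* The complex field is algebraically closed, so the roots form a finite list; if -c is one of them,
   c is minus its real part. The transpose appears because eigenvectors are row vectors here. *)
have [rs rsE] := closed_field_poly_normal (char_poly B^T).
apply: (@sub_finite_set _ _ [set` [seq - complex.Re z | z <- rs]]); last first.
  by apply/finite_seqP; exists [seq - complex.Re z | z <- rs].
move=> c /= /gram_singular[u u0 Hu].
have Bu : B *m u = (- c%:C%C) *: u.
  have := channel_line x c; move/(congr1 (fun M => M *m u)).
  rewrite mul_rowsub_mx Hu mulmxDl mul_scalar_mx => h.
  apply/eqP; rewrite scaleNr -addr_eq0 -h; apply/eqP.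
  by apply/matrixP => i j; rewrite !mxE.
have : root (char_poly B^T) (- c%:C%C).
  rewrite -eigenvalue_root_char; apply/eigenvalueP; exists u^T.
    by rewrite -trmx_mul Bu linearZ.
  by apply: contra u0 => /eqP h; rewrite -[u]trmxK h trmx0.
rewrite rsE (monicP (char_poly_monic _)) scale1r root_prod_XsubC => crs.
by apply/mapP; exists (- c%:C%C) => //; rewrite /= opprK.
Qed.

End random_channel.

(** * Channel and noise as one independent family *)

Section channel_family.
Context (R : realType) d (T : measurableType d) (P : probability T R) (n r t k : nat).
Local Notation I := ('I_n * 'I_r * 'I_t * bool)%type.
Local Notation K := #|{: I}|.
Variables (Hre Him : 'I_n -> 'I_r -> 'I_t -> T -> R) (Wre Wim : 'I_k -> T -> R).

Definition channel_rv (j : 'I_K) : T -> R :=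
  let: (i, a, b, c) := (enum_val j : I) in if c then Hre i a b else Him i a b.

Lemma channel_of_vec w : channel_of (vec_of channel_rv w) = chan_mat Hre Him w.
Proof.
rewrite /channel_of /chan_mat /blockdiag; apply/matrixP => J J'; rewrite !mxE.
case: ifP => // _; rewrite /coord_re /coord_im !mxE /channel_rv.
by rewrite !enum_rankK.
Qed.

Lemma realv_cvec w : realv (cvec Wre Wim w) = vec_of (joint Wre Wim) w.
Proof.
rewrite vec_of_joint /realv; congr col_mx; apply/colP => j; by rewrite !mxE.
Qed.

Definition family_index (j : 'I_(K + (k + k))) : (I + 'I_k * bool)%type :=
  match fintype.split j with
  | inl i => inl (enum_val i)
  | inr i => inr (match fintype.split i with inl a => (a, true) | inr b => (b, false) end)
  end.

Lemma family_index_inj : injective family_index.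
Proof.
move=> x y; rewrite /family_index => e; rewrite -[x]splitK -[y]splitK; congr unsplit.
case: (fintype.split x) (fintype.split y) e => [a|a] [b|b] //.
  by move=> [/enum_val_inj ->].
move=> e; congr inr; rewrite -[a]splitK -[b]splitK; congr unsplit.
by case: (fintype.split a) (fintype.split b) e => [a'|a'] [b'|b'] // [->].
Qed.

Lemma joint_independent :
  mutually_independent P (HW_family Hre Him Wre Wim) ->
  box_independent P (joint channel_rv (joint Wre Wim)).
Proof.
move=> iHW; have := mutually_independent_box family_index_inj iHW.
congr box_independent; apply/funext => j; rewrite /family_index /joint /channel_rv.
case: (fintype.split j) => [i|i] /=; first by case: (enum_val i) => [[[? ?] ?] ?].
by case: (fintype.split i).
Qed.

Lemma joint_ind (Q : (T -> R) -> Prop) :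
  (forall j, Q (Wre j)) -> (forall j, Q (Wim j)) -> forall j, Q (joint Wre Wim j).
Proof. by move=> h1 h2 j; rewrite /joint; case: (fintype.split j). Qed.

Lemma channel_rv_ind (Q : (T -> R) -> Prop) :
  (forall i a b, Q (Hre i a b)) -> (forall i a b, Q (Him i a b)) ->
  forall j, Q (channel_rv j).
Proof.
move=> h1 h2 j; rewrite /channel_rv; case: (enum_val j) => [[[i a] b] c].
by case: c.
Qed.

End channel_family.

(** With delta = ln gamma / n, the factor e^(-delta/t) raised to the power nt is 1/gamma. As [r2] is
    a squared radius, the ball volume carries the exponent nt, and the claim says that the ellipsoid
    has volume 1/gamma. *)
Lemma radius_power (R : realType) (n t : nat) (gamma D : R) :
  (0 < n)%N -> (0 < t)%N -> 0 < gamma -> 0 < D ->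
  let r2 := expR (- (ln gamma / n%:R) / t%:R) *
    powR (D / Vball R (n * t)) ((n * t)%N%:R)^-1 in
  0 < r2 /\ Vball R (n * t) * r2 ^+ (n * t) = D / gamma.
Proof.
move=> n0 t0 g0 D0 r2.
have V0 : 0 < Vball R (n * t).
  by rewrite divr_gt0 ?exprn_gt0 ?pi_gt0 // ltr0n fact_gt0.
have n0' : n%:R != 0 :> R by rewrite pnatr_eq0 -lt0n.
have t0' : t%:R != 0 :> R by rewrite pnatr_eq0 -lt0n.
have DV : 0 < D / Vball R (n * t) by rewrite divr_gt0.
split; first by rewrite mulr_gt0 ?expR_gt0 // powR_gt0.
rewrite exprMn -expRM_natl -powR_mulrn ?powR_ge0 // -powRrM mulVf ?powRr1 ?ltW //; last first.
  by rewrite pnatr_eq0 muln_eq0 negb_or -!lt0n n0 t0.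
have -> : (n * t)%:R * (- (ln gamma / n%:R) / t%:R) = - ln gamma :> R.
  by rewrite natrM; field; rewrite n0' t0'.
rewrite expRN lnK ?posrE // mulrCA [X in _ * X]mulrC divfK ?gt_eqF //.
by rewrite mulrC.
Qed.

Unset Implicit Arguments.

Theorem theorem5p2 (R : realType) (d : measure_display) (T : measurableType d)
    (P : probability T R) (n t r : nat) (sigma : R)
    (Hre Him : 'I_n -> 'I_r -> 'I_t -> {RV P >-> R})
    (zre zim : 'I_(n * r) -> {RV P >-> R})
    (zpre zpim : 'I_(n * t) -> {RV P >-> R})
    (S : set 'cV[R[i]]_(n * t)) (gamma delta : R) :
  (0 < n)%N -> (0 < t)%N -> (t <= r)%N -> 0 < sigma ->
  (* H^n has i.i.d. CN(0,1) entries: independent N(0,1/2) real/imag parts *)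
  (forall i a b, is_gaussian0 P (Num.sqrt (2^-1)) (Hre i a b) /\
                 is_gaussian0 P (Num.sqrt (2^-1)) (Him i a b)) ->
  (* z^n ~ CN(0, sigma^2 I_(nr)) *)
  (forall k, is_gaussian0 P (sigma * Num.sqrt (2^-1)) (zre k) /\
             is_gaussian0 P (sigma * Num.sqrt (2^-1)) (zim k)) ->
  (* z'^n ~ CN(0, sigma^2 I_(nt)) *)
  (forall k, is_gaussian0 P (sigma * Num.sqrt (2^-1)) (zpre k) /\
             is_gaussian0 P (sigma * Num.sqrt (2^-1)) (zpim k)) ->
  (* H^n and z^n independent (all real coordinates mutually independent) *)
  mutually_independent P
    (HW_family (fun i a b => Hre i a b : T -> R) (fun i a b => Him i a b : T -> R)
               (fun k => zre k : T -> R) (fun k => zim k : T -> R)) ->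
  (* H^n and z'^n independent *)
  mutually_independent P
    (HW_family (fun i a b => Hre i a b : T -> R) (fun i a b => Him i a b : T -> R)
               (fun k => zpre k : T -> R) (fun k => zpim k : T -> R)) ->
  (* S is an infinite constellation of complex dimension nt with NLD delta *)
  countable S ->
  density S = gamma%:E -> 0 < gamma -> delta = ln gamma / n%:R ->
  let Hn := chan_mat (fun i a b => Hre i a b : T -> R)
                     (fun i a b => Him i a b : T -> R) in
  let z := cvec (fun k => zre k : T -> R) (fun k => zim k : T -> R) in
  let z' := cvec (fun k => zpre k : T -> R) (fun k => zpim k : T -> R) in
  (P [set w : T | (expR (- delta / t%:R) *
                powR (complex.Re (\det (adjoint (Hn w) *m Hn w)) / @Vball R (n * t)%N)
                     ((n * t)%N%:R)^-1
              <= normsq (z' w))%R]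
   <= err_prob P S Hn z)%E.
Proof.
move=> n0 t0 tr sigma0 gH gz gz' iHz iHz' cS dS gamma0 -> /=.
set Hn := chan_mat _ _.
set z := cvec (fun k => zre k : T -> R) _.
set z' := cvec (fun k => zpre k : T -> R) _.
have lm : (n * t <= n * r)%N by rewrite leq_mul2l tr orbT.
pose s : R := sigma * Num.sqrt (2^-1).
have s0 : s != 0 by rewrite mulf_neq0 ?gt_eqF // sqrtr_gt0 invr_gt0.
pose XH := channel_rv (fun i a b => Hre i a b : T -> R) (fun i a b => Him i a b : T -> R).
pose Z := joint (fun k => zre k : T -> R) (fun k => zim k : T -> R).
pose Z' := joint (fun k => zpre k : T -> R) (fun k => zpim k : T -> R).
have mRV (X : {RV P >-> R}) : measurable_fun setT (X : T -> R) by [].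
have mXH k : measurable_fun setT (XH k) by apply: channel_rv_ind => *; exact: mRV.
have mZ k : measurable_fun setT (Z k) by apply: joint_ind => *; exact: mRV.
have mZ' k : measurable_fun setT (Z' k) by apply: joint_ind => *; exact: mRV.
have [_ iZ _] := joint_box (joint_independent iHz).
have iXZ' := joint_independent iHz'.
have [iXH iZ' _] := joint_box iXZ'.
have gXH k : is_gaussian0 P (Num.sqrt (2^-1)) (XH k).
  by apply: channel_rv_ind => i a b; have [] := gH i a b.
have gZ k : is_gaussian0 P s (Z k) by apply: joint_ind => j; have [] := gz j.
have gZ' k : is_gaussian0 P s (Z' k) by apply: joint_ind => j; have [] := gz' j.
have lawZ B := gaussian_law (B := B) mZ iZ gZ.
have lawZ' B := gaussian_law (B := B) mZ' iZ' gZ'.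
pose D (x : 'cV[R]_#|{: 'I_n * 'I_r * 'I_t * bool}|) :=
  complex.Re (\det (adjoint (channel_of x) *m channel_of x)).
have HnE w : Hn w = channel_of (vec_of XH w) by rewrite channel_of_vec.
pose r2 x := expR (- (ln gamma / n%:R) / t%:R) *
  powR (D x / Vball R (n * t)) ((n * t)%N%:R)^-1.
have mD : measurable_fun setT D by exact: measurable_gram_det.
have mr2 : measurable_fun setT r2.
  apply: measurable_funM => //; apply: (measurableT_comp (measurable_powR _)).
  exact: measurable_funM.
pose E : set ('cV[R]_#|{: 'I_n * 'I_r * 'I_t * bool}| * 'cV[R]_(n * t + n * t)) :=
  [set p | r2 p.1 <= sqn p.2].
have mE : measurable E := measurable_le_prod mr2 (@measurable_sqn R _).
(* Independence of the channel and z' writes the target probability as an integral over channel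
   realisations, to be compared pointwise with the integrand of [err_prob]. *)
have [mF PE] := independent_integral mXH mZ' iXZ' mE.
pose F x := P [set w' | E (x, vec_of Z' w')].
have PF : P [set w | E (vec_of XH w, vec_of Z' w)] = (\int[P]_w F (vec_of XH w))%E.
  exact: PE.
rewrite [X in (P X <= _)%E](_ : _ = [set w | E (vec_of XH w, vec_of Z' w)]); last first.
  by apply/seteqP; split => w; rewrite /E /= HnE -sqn_realv realv_cvec.
rewrite PF.
pose sing := vec_of XH @^-1` [set x | D x = 0].
have msing : measurable sing.
  have m0 : measurable [set x | D x = 0] by have := mD measurableT _ (measurable_set1 0); rewrite setTI.
  by have := measurable_vec_of mXH measurableT m0; rewrite setTI.
have Psing : P sing = 0%E.
  have m0 : measurable [set x | D x = 0] by have := mD measurableT _ (measurable_set1 0); rewrite setTI.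
  rewrite (gaussian_law mXH iXH gXH m0); apply: null_set_integral => //.
    by apply: measurable_funTS; exact: measurable_gauss_density.
  exact: singular_null.
have mFw : measurable_fun setT (fun w => F (vec_of XH w)).
  exact: (measurableT_comp mF (measurable_vec_of mXH)).
(* Rank-deficient realisations have probability zero; removing them on the smaller side confines the
   comparison to nonzero Gram determinants. *)
rewrite (ge0_negligible_integral msing) // integral_mkcond /err_prob.
apply: ge0_le_integral_nonmeasurable => w.
  by apply: erestrict_ge0.
(* On the removed event the left integrand is 0, and it remains to see that the upper limit of
   nonnegative values is nonnegative, neighbourhoods of infinity being nonempty. *)
rewrite patchE; case: ifPn => [/set_mem[_ wsing]|_]; last first.
  apply: limf_esup_ge0; first by move=> [M [_ /(_ (M + 1))]]; apply; rewrite ltrDl.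
  move=> a; rewrite mule_ge0 //; first exact: esum_ge0.
  by rewrite lee_fin invr_ge0 fine_ge0 // esum_ge0.
have D0 : complex.Re (\det (adjoint (Hn w) *m Hn w)) != 0.
  by apply/eqP => h; apply: wsing; rewrite /sing /= /D -HnE.
have Dgt0 := det_gram_gt0 lm D0.
have [r20 r2E] := radius_power n0 t0 gamma0 Dgt0.
have zX w' : realv (z w') = vec_of Z w' by exact: realv_cvec.
have := fixed_channel_bound lm D0 s0 mZ lawZ zX cS gamma0 r20 r2E dS.
apply: le_trans.
set rr := (_ * _) in r20 r2E *.
have mray : measurable [set y : R | rr <= y].
  rewrite (_ : [set y | _] = `[rr, +oo[%classic); first exact: measurable_itv.
  by apply/seteqP; split => y /=; rewrite in_itv /= andbT.
(* For the event that the squared norm is at least the squared radius, the projected noise and z'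
   have the same probability. *)
have := nu_form lm D0 s0 mray => ->.
rewrite -lawZ'; last first.
  have := @measurable_sqn R (n * t + n * t) measurableT _ mray; by rewrite setTI.
have FE : [set w' | E (vec_of XH w, vec_of Z' w')] =
    vec_of Z' @^-1` [set x | rr <= sqn x].
  by apply/seteqP; split => w'; rewrite /E /r2 /D /rr /= HnE.
by rewrite /F FE.
Qed.
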